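(* Let $P$ be a fixed real polynomial. There exist a deterministic algorithm and a polynomial $Q$ (depending only on $P$) such that the following holds. Let $n\in\mathbb{N}$, $n \ge 1$, let $C_0,C_1\in\mathbb{R}^n$, $r_0,r_1>0$ and $\delta\in(0,1)$, and suppose that for each $i\in\{0,1\}$: $\min_{x\in\mathcal{U}}\|x-C_i\|\ge 1$, $\max_{x\in\mathcal{U}}\left|r_i^2-\|x-C_i\|^2\right|\le P(n)$ and $\left\|C_i-\tfrac12\cdot 1_{n\times 1}\right\|\le P(n)$. Then, on input $(n,C_0,C_1,r_0,r_1,\delta)$, the algorithm outputs a real number $V$ with $\left|V-\mathrm{vol}\left(\mathcal{U}\cap\bar{\mathcal{B}}(C_0,r_0)\cap\bar{\mathcal{B}}(C_1,r_1)\right)\right|\le\delta$, using at most $Q(n,1/\delta)^{1+\log_2 n}$ real arithmetic operations (quasi-polynomial complexity).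
   Context: $\mathcal{U}=\{x\in\mathbb{R}^n : 0\le x_i\le 1,\ i=1,\dots,n\}$ is the unit hypercube, $1_{n\times1}\in\mathbb{R}^n$ is the all-ones vector, $\|\cdot\|$ is the Euclidean norm, $\bar{\mathcal{B}}(C,r)$ is the closed ball of center $C$ and radius $r$, and $\mathrm{vol}$ is $n$-dimensional Lebesgue measure. Real arithmetic operations are additions, subtractions, multiplications, divisions and comparisons of real numbers, each counted at unit cost. *)

(* Defs.v *)
From mathcomp Require Import all_boot all_order all_algebra.
From mathcomp Require Import all_classical all_reals all_analysis.

Set Implicit Arguments.
Unset Strict Implicit.
Unset Printing Implicit Defensive.

Import Order.TTheory GRing.Theory Num.Theory.
Import numFieldNormedType.Exports.

Local Open Scope classical_set_scope.
Local Open Scope ring_scope.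

(* The norm that mathcomp-analysis puts on 'rV[R]_n is the max norm, hence
   this separate definition. *)
Definition enorm (R : realType) (n : nat) (x : 'rV[R]_n) : R :=
  Num.sqrt (\sum_(i < n) x 0 i ^+ 2).

Definition closed_eball (R : realType) (n : nat) (C : 'rV[R]_n) (r : R) :
  set 'rV[R]_n := [set x | enorm (x - C) <= r].

Definition cbox (R : realType) (n : nat) (a b : 'rV[R]_n) : set 'rV[R]_n :=
  [set x | forall i, a 0 i <= x 0 i <= b 0 i].

Definition unit_cube (R : realType) (n : nat) : set 'rV[R]_n :=
  cbox (const_mx 0) (const_mx 1).
Arguments unit_cube : clear implicits.

(* n-dimensional Lebesgue (outer) measure: the infimum of the total volume of
   the countable coverings by closed boxes. It is only applied to a compact,
   hence measurable, set. *)
Definition vol (R : realType) (n : nat) (A : set 'rV[R]_n) : \bar R :=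
  ereal_inf [set v | exists a b : nat -> 'rV[R]_n,
    [/\ forall k i, a k 0 i <= b k 0 i,
        A `<=` \bigcup_k cbox (a k) (b k) &
        v = (\sum_(0 <= k <oo) (\prod_(i < n) (b k 0 i - a k 0 i))%:E)%E]].

Definition log2 (R : realType) (x : R) : R := ln x / ln 2.

(* Real RAM: finitely many real variables and finitely many real arrays, both
   named by natural numbers. All data are reals, including loop counters and
   array indices, so that index computations are charged as real operations.
   A program is a finite object: its only constants are rational numbers. *)
Variant arith_op := Add | Sub | Mul | Div.
Variant cmp_op := Lt | Le.

Inductive expr :=
| Cst of rat
| Var of nat
| Get of nat & expr
| Op of arith_op & expr & expr.

Inductive prog :=
| Skip
| Assign of nat & expr
| Put of nat & expr & expr
| Seq of prog & prog
| If of cmp_op & expr & expr & prog & prog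
| While of cmp_op & expr & expr & prog.

Record state (R : realType) := State {
  vars : nat -> R ;
  arrs : nat -> nat -> R }.

Definition set_var (R : realType) (s : state R) (x : nat) (v : R) : state R :=
  State (fun y => if y == x then v else vars s y) (arrs s).

Definition set_arr (R : realType) (s : state R) (a k : nat) (v : R) : state R :=
  State (vars s)
    (fun b j => if (b == a) && (j == k) then v else arrs s b j).

Definition eval_op (R : realType) (o : arith_op) (x y : R) : option R :=
  match o with
  | Add => Some (x + y)
  | Sub => Some (x - y)
  | Mul => Some (x * y)
  | Div => if y == 0 then None else Some (x / y)
  end.

Definition eval_cmp (R : realType) (o : cmp_op) (x y : R) : bool :=
  match o with Lt => x < y | Le => x <= y end.

(* A real used as an array index must be a natural number; otherwise the
   machine is stuck. In particular indexing gives no access to a floor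
   function. *)
Definition eval_index (R : realType) (x : R) : option nat :=
  if x \is a Num.nat then Some (Num.truncn x) else None.

Fixpoint eval (R : realType) (s : state R) (e : expr) : option R :=
  match e with
  | Cst q => Some (ratr q)
  | Var x => Some (vars s x)
  | Get a e1 => obind (fun v => omap (arrs s a) (eval_index v)) (eval s e1)
  | Op o e1 e2 =>
      obind (fun v1 => obind (fun v2 => eval_op o v1 v2) (eval s e2))
            (eval s e1)
  end.

Fixpoint cost (e : expr) : nat :=
  match e with
  | Cst _ | Var _ => 0
  | Get _ e1 => cost e1
  | Op _ e1 e2 => (cost e1 + cost e2).+1
  end.

(* exec p s s' k: started in s, p halts in s' after k additions, subtractions,
   multiplications, divisions and comparisons. Data movement is not counted;
   since control only branches on counted comparisons, the number of all
   elementary steps is at most a constant (depending on p) times k.+1. A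
   program that gets stuck or loops forever has no execution. *)
Inductive exec (R : realType) : prog -> state R -> state R -> nat -> Prop :=
| ExecSkip s : exec Skip s s 0
| ExecAssign s x e v : eval s e = Some v ->
    exec (Assign x e) s (set_var s x v) (cost e)
| ExecPut s a ei e i k v :
    eval s ei = Some i -> eval_index i = Some k -> eval s e = Some v ->
    exec (Put a ei e) s (set_arr s a k v) (cost ei + cost e)
| ExecSeq p1 p2 s1 s2 s3 k1 k2 :
    exec p1 s1 s2 k1 -> exec p2 s2 s3 k2 -> exec (Seq p1 p2) s1 s3 (k1 + k2)
| ExecIf o e1 e2 p1 p2 s s' v1 v2 k :
    eval s e1 = Some v1 -> eval s e2 = Some v2 ->
    exec (if eval_cmp o v1 v2 then p1 else p2) s s' k ->
    exec (If o e1 e2 p1 p2) s s' ((cost e1 + cost e2).+1 + k)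
| ExecWhileF o e1 e2 p s v1 v2 :
    eval s e1 = Some v1 -> eval s e2 = Some v2 -> eval_cmp o v1 v2 = false ->
    exec (While o e1 e2 p) s s (cost e1 + cost e2).+1
| ExecWhileT o e1 e2 p s s' s'' v1 v2 k k' :
    eval s e1 = Some v1 -> eval s e2 = Some v2 -> eval_cmp o v1 v2 = true ->
    exec p s s' k -> exec (While o e1 e2 p) s' s'' k' ->
    exec (While o e1 e2 p) s s'' ((cost e1 + cost e2).+1 + k + k').

Lemma exec_deterministic (R : realType) (p : prog) (s s1 s2 : state R)
    (k1 k2 : nat) :
  exec p s s1 k1 -> exec p s s2 k2 -> s1 = s2 /\ k1 = k2.
Proof.
move=> h; elim: h s2 k2 => {p s s1 k1}.
- by move=> s s2 k2 h; inversion h.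
- by move=> s x e v he s2 k2 h; inversion h; subst; split; congruence.
- move=> s a ei e i k v hi hk he s2 k2 h; inversion h; subst.
  by split=> //; congruence.
- move=> p1 p2 s1 s2 s3 k1 k2 _ ih1 _ ih2 s' k' h; inversion h; subst.
  match goal with H1 : exec p1 _ _ _, H2 : exec p2 _ _ _ |- _ =>
    have [? ?] := ih1 _ _ H1; subst; by have [-> ->] := ih2 _ _ H2 end.
- move=> o e1 e2 p1 p2 s s' v1 v2 k h1 h2 _ ih s'' k' h; inversion h; subst.
  have [? ?] : v1 = v0 /\ v2 = v3 by split; congruence.
  subst; match goal with H : exec (if _ then _ else _) _ _ _ |- _ =>
    by have [-> ->] := ih _ _ H end.
- move=> o e1 e2 p s v1 v2 h1 h2 h3 s' k' h; inversion h; subst => //.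
  have [? ?] : v1 = v0 /\ v2 = v3 by split; congruence.
  by subst; congruence.
- move=> o e1 e2 p s s' s'' v1 v2 k k' h1 h2 h3 _ ih1 _ ih2 t l h.
  inversion h; subst.
    have [? ?] : v1 = v0 /\ v2 = v3 by split; congruence.
    by subst; congruence.
  match goal with H1 : exec p _ _ _, H2 : exec (While _ _ _ _) _ _ _ |- _ =>
    have [? ?] := ih1 _ _ H1; subst; by have [-> ->] := ih2 _ _ H2 end.
Qed.

Definition coords (R : realType) (n : nat) (x : 'rV[R]_n) (k : nat) : R :=
  if insub k is Some i then x 0 i else 0.

(* Variables 0, 1, 2, 3 hold n, r0, r1, delta; arrays 0 and 1 hold the
   coordinates of C0 and C1; every other cell holds 0. *)
Definition input (R : realType) (n : nat) (C0 C1 : 'rV[R]_n)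
    (r0 r1 delta : R) : state R :=
  State (nth 0 [:: n%:R; r0; r1; delta])
        (fun a => nth (fun=> 0) [:: coords C0; coords C1] a).

Definition output (R : realType) (s : state R) : R := vars s 0.

(* Main.v *)
Require Import Defs.
From mathcomp Require Import all_boot all_order all_algebra.
From mathcomp Require Import all_classical all_reals all_analysis.
From mathcomp Require Import measurable_realfun ring lra zify.
Import Order.TTheory GRing.Theory Num.Theory.
Import numFieldNormedType.Exports.
Local Open Scope classical_set_scope.
Local Open Scope ring_scope.

Set Implicit Arguments.
Unset Strict Implicit.
Unset Printing Implicit Defensive.

(** The volume is a probability: for x uniform in the cube, the events are
that the two sums of the n independent terms (x_i - c_i)^2 are at most r0^2
and r1^2. Cut each edge of the cube into M equal pieces and round the terms
down to multiples of 1/M. The joint law of the two rounded sums is then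
supported on a grid of polynomial size, so that dynamic programming over the
coordinates computes it exactly. The n-th row of the table is the coefficient
sequence of a product of n polynomials (gen), one factor per coordinate, both
sums being packed in one exponent. Summing the entries below the two
thresholds gives the proportion of accepted cells (sum_accepted_entry).

Rounding only matters for the cells on which a sum lies within O(n (p + 1) / M)
of its threshold, where p bounds the distance from the center of the cube to
the centers of the balls. Those cells are few: a center at distance at
least 1 from the cube is at distance at least 1/n from [0, 1] in some
coordinate j (far_coord), so its j-th term is strictly monotone with slope at
least 2/n, and on each line parallel to the j-th axis only polynomially many
cells are close to the sphere, a bound that does not depend on M
(card_near_sphere). Taking M to be D >= 1/delta times twice that bound makes
the error at most delta (vol_approx).

The measure vol is compared with cell counts from above by a covering and
from below by le_sum_volume: a pointwise inequality between sums of
indicators of boxes passes to the volumes, by integrating one coordinate at a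
time.

The number of operations is at most (d + 100) W^4, where W bounds the scores,
hence polynomial in n and 1/delta, and a fortiori below the required bound,
because the exponent 1 + log2 n is at least 1. The polynomial P enters the
program only through two naturals K and d such that the monomial K n^d
dominates everything needed. *)

(** * Volumes and counts of grid cells *)

(** Both sides are integrals of the sums of indicators, the right one by
monotone convergence. *)
Lemma le_sum_lebesgue (R : realType) (T : finType)
    (d : T -> \bar R) (J : T -> set R) (c : nat -> \bar R) (I : nat -> set R) :
  (forall t, 0 <= d t)%E -> (forall k, 0 <= c k)%E ->
  (forall t, measurable (J t)) -> (forall k, measurable (I k)) ->
  (forall x, \sum_t d t * (\1_(J t) x)%:E
             <= \sum_(0 <= k <oo) c k * (\1_(I k) x)%:E)%E ->
  (\sum_t d t * lebesgue_measure (J t)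
   <= \sum_(0 <= k <oo) c k * lebesgue_measure (I k))%E.
Proof.
move=> d0 c0 mJ mI le_dc; pose mu := @lebesgue_measure R.
have ind0 (A : set R) x : (0 <= (\1_A x)%:E :> \bar R)%E.
  by rewrite lee_fin indicE ler0n.
have mind (A : set R) : measurable A ->
    measurable_fun [set: R] (EFin \o (\1_A : R -> R)).
  by move=> mA; apply/measurable_EFinP; exact: measurable_indic.
have int_ind (A : set R) (k : \bar R) : measurable A -> (0 <= k)%E ->
    (k * mu A = \int[mu]_x (k * (\1_A x)%:E))%E.
  move=> mA k0; rewrite ge0_integralZl//; last exact: mind.
  by rewrite integral_indic// setIT.
under eq_bigr => t _ do rewrite int_ind//.
under eq_eseriesr => k _ do rewrite int_ind//.
rewrite -ge0_integral_sum//; last 2 first.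
- by move=> t; apply: measurable_funeM; exact: mind.
- by move=> t x _; exact: mule_ge0.
rewrite -integral_nneseries//; last 2 first.
- by move=> k; apply: measurable_funeM; exact: mind.
- by move=> k x _; exact: mule_ge0.
apply: ge0_le_integral => //.
- by move=> x _; apply: sume_ge0 => t _; exact: mule_ge0.
- by apply: emeasurable_sum => t; apply: measurable_funeM; exact: mind.
- apply: (@ge0_emeasurable_sum _ _ _ _ _ xpredT).
  + by move=> k x _ _; exact: mule_ge0.
  + by move=> k _; apply: measurable_funeM; exact: mind.
Qed.

(** By induction on the dimension: freezing the last coordinate at y turns
its indicators into coefficients, the induction hypothesis applies for each y,
and integrating over y restores the last side lengths. *)
Lemma le_sum_volume (R : realType) (n : nat) (T : finType)
    (d : T -> \bar R) (J : T -> nat -> set R)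
    (c : nat -> \bar R) (I : nat -> nat -> set R) :
  (forall t, 0 <= d t)%E -> (forall k, 0 <= c k)%E ->
  (forall t i, measurable (J t i)) -> (forall k i, measurable (I k i)) ->
  (forall x : nat -> R,
     \sum_t d t * \prod_(i < n) (\1_(J t i) (x i))%:E
     <= \sum_(0 <= k <oo) c k * \prod_(i < n) (\1_(I k i) (x i))%:E)%E ->
  (\sum_t d t * \prod_(i < n) lebesgue_measure (J t i)
   <= \sum_(0 <= k <oo) c k * \prod_(i < n) lebesgue_measure (I k i))%E.
Proof.
have ind0 (A : set R) x : (0 <= (\1_A x)%:E :> \bar R)%E.
  by rewrite lee_fin indicE ler0n.
elim: n d c => [|n IH] d c d0 c0 mJ mI le_dc.
  have := le_dc (fun=> 0).
  under eq_bigr => t _ do rewrite big_ord0.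
  under eq_eseriesr => k _ do rewrite big_ord0.
  under [in X in _ -> X]eq_bigr => t _ do rewrite big_ord0.
  by under [in X in _ -> X]eq_eseriesr => k _ do rewrite big_ord0.
have swap (a b e : \bar R) : (a * (b * e) = a * e * b)%E.
  by rewrite [(b * e)%E]muleC muleA.
under eq_bigr => t _ do rewrite big_ord_recr /= muleA.
under eq_eseriesr => k _ do rewrite big_ord_recr /= muleA.
have prod0 (A : nat -> set R) :
    (0 <= \prod_(i < n) lebesgue_measure (A i))%E.
  by apply: (big_ind (fun x => (0 <= x)%E)) => // x y; exact: mule_ge0.
apply: le_sum_lebesgue => // [t|k|y]; try exact: mule_ge0.
have /IH : forall t, (0 <= d t * (\1_(J t n) y)%:E)%E.
  by move=> t; exact: mule_ge0.
move=> /(_ (fun k => c k * (\1_(I k n) y)%:E)%E) IH'.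
under eq_bigr => t _ do rewrite -muleA [(_ * _%:E)%E]muleC muleA.
under eq_eseriesr => k _ do rewrite -muleA [(_ * _%:E)%E]muleC muleA.
apply: IH' => // [k|x]; first exact: mule_ge0.
have := le_dc (fun i => if i == n then y else x i).
have E (A : nat -> set R) :
    (\prod_(i < n.+1) (\1_(A i) (if i == n :> nat then y else x i))%:E
     = (\1_(A n) y)%:E * \prod_(i < n) (\1_(A i) (x i))%:E :> \bar R)%E.
  rewrite big_ord_recr /= eqxx muleC; congr (_ * _)%E.
  by apply: eq_bigr => i _; rewrite ltn_eqF.
under eq_bigr => t _ do rewrite (E (J t)) muleA.
by under eq_eseriesr => k _ do rewrite (E (I k)) muleA.
Qed.

Definition cell_lo (R : realType) (n M : nat) (m : {ffun 'I_n -> 'I_M}) :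
  'rV[R]_n := \row_i ((m i)%:R / M%:R).

Definition cell_hi (R : realType) (n M : nat) (m : {ffun 'I_n -> 'I_M}) :
  'rV[R]_n := \row_i ((m i).+1%:R / M%:R).

Definition cell (R : realType) (n M : nat) (m : {ffun 'I_n -> 'I_M}) :
  set 'rV[R]_n := cbox (cell_lo R m) (cell_hi R m).
Arguments cell : clear implicits.

(** The cells of G are padded to a sequence with the degenerate box [0, 0],
whose volume vanishes because n > 0. *)
Lemma vol_le_cells (R : realType) (n M : nat) (A : set 'rV[R]_n)
    (G : {set {ffun 'I_n -> 'I_M}}) :
  (0 < n)%N -> (forall x, A x -> exists2 m, m \in G & cell R n M m x) ->
  (vol A <= (#|G|%:R / M%:R ^+ n)%:E)%E.
Proof.
move=> n0 AG.
pose a k := nth 0 [seq cell_lo R m | m <- enum G] k.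
pose b k := nth 0 [seq cell_hi R m | m <- enum G] k.
have inG k (kG : (k < #|G|)%N) : exists2 m, m \in G &
    a k = cell_lo R m /\ b k = cell_hi R m.
  have kG' : (k < size (enum G))%N by rewrite -cardE.
  have [m0 _] : exists m0 : {ffun 'I_n -> 'I_M}, true.
    by case E : (enum G) kG' => [//|m0 s] _; exists m0.
  exists (nth m0 (enum G) k); first by rewrite -mem_enum mem_nth.
  by rewrite /a /b !(nth_map m0).
have outG k : (#|G| <= k)%N -> a k = 0 /\ b k = 0.
  by move=> Gk; rewrite /a /b !nth_default // size_map -cardE.
have prodE k : \prod_(i < n) (b k 0 i - a k 0 i)
    = (if (k < #|G|)%N then M%:R^-1 ^+ n else 0 : R).
  case: ltnP => [/inG[m _ [-> ->]]|/outG[-> ->]].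
    rewrite -[n in RHS]card_ord -prodr_const; apply: eq_bigr => i _.
    by rewrite !mxE -mulrBl -natrB // subSnn mul1r.
  by rewrite (bigD1 (Ordinal n0)) //= mxE subrr mul0r.
apply: ereal_inf_lbound; exists a, b; split.
- move=> k i; case: (ltnP k #|G|) => [/inG[m _ [-> ->]]|/outG[-> ->]] //.
  by rewrite !mxE ler_wpM2r ?invr_ge0// ler_nat.
- move=> x /AG[m mG mx]; exists (index m (enum G)) => //.
  have iG : (index m (enum G) < size (enum G))%N by rewrite index_mem mem_enum.
  by rewrite /a /b !(nth_map m)// !nth_index ?mem_enum.
- under eq_eseriesr => k _ do rewrite prodE.
  rewrite (@nneseries_split _ _ 0 #|G|); last first.
    by move=> k _; rewrite lee_fin; case: ifP => // _; exact/exprn_ge0.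
  rewrite add0n eseries0 ?adde0; last first.
    by move=> k Gk _; rewrite ltnNge Gk.
  rewrite sumEFin big_mkord.
  under eq_bigr => k _ do rewrite ltn_ord.
  by rewrite sumr_const card_ord exprVn mulr_natl.
Qed.

Lemma prod_lebesgue_itv (R : realType) (n : nat) (I : nat -> set R)
    (l : 'I_n -> R) :
  (forall i : 'I_n, lebesgue_measure (I i) = (l i)%:E) ->
  (\prod_(i < n) lebesgue_measure (I i) = (\prod_i l i)%:E)%E.
Proof.
by move=> Il; rewrite -prodEFin; apply: eq_bigr => i _; rewrite Il.
Qed.

(** Half-open cells are disjoint, so the sum of their indicators is at most 1,
and it vanishes off A; any covering of A by boxes therefore dominates it
pointwise. *)
Lemma vol_ge_cells (R : realType) (n M : nat) (A : set 'rV[R]_n)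
    (G : {set {ffun 'I_n -> 'I_M}}) :
  (0 < M)%N -> (forall m x, m \in G -> cell R n M m x -> A x) ->
  ((#|G|%:R / M%:R ^+ n)%:E <= vol A)%E.
Proof.
move=> M0 GA; have M0' : 0 < M%:R :> R by rewrite ltr0n.
apply: le_ereal_inf_tmp => _ [a [b [ab Aab ->]]].
(* Only the indices below n matter: the default intervals are arbitrary
   measurable sets. *)
pose J (m : {ffun 'I_n -> 'I_M}) k : set R :=
  [set` (if insub k is Some i then `[cell_lo R m 0 i, cell_hi R m 0 i[
         else `[0, 0[)%R].
pose I k j : set R :=
  [set` (if insub j is Some i then `[a k 0 i, b k 0 i] else `[0, 0])%R].
have JE m (i : 'I_n) : J m i = `[cell_lo R m 0 i, cell_hi R m 0 i[%classic.
  by rewrite /J valK.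
have IE k (i : 'I_n) : I k i = `[a k 0 i, b k 0 i]%classic.
  by rewrite /I valK.
have /(@le_sum_volume R n _ (fun m => (m \in G)%:R%:E) J (fun=> 1%E) I) :
    forall m, (0 <= ((m \in G)%:R : R)%:E)%E by move=> m; rewrite lee_fin ler0n.
have -> : (\sum_t (t \in G)%:R%:E * \prod_(i < n) lebesgue_measure (J t i)
          = (#|G|%:R / M%:R ^+ n)%:E)%E.
  under eq_bigr => m _.
    rewrite (prod_lebesgue_itv (l := fun=> M%:R^-1)); last first.
      move=> i; rewrite JE lebesgue_measure_itv /= !mxE lte_fin.
      rewrite ltr_pM2r ?invr_gt0// ltr_nat ltnSn -EFinB -mulrBl.
      by rewrite -natrB// subSnn mul1r.
    rewrite -EFinM.
    over.
  rewrite sumEFin -mulr_suml prodr_const card_ord exprVn.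
  by rewrite -natr_sum -sum1_card [in RHS]big_mkcond; congr (_%:R * _)%:E.
under eq_eseriesr => k _.
  rewrite mul1e (prod_lebesgue_itv (l := fun i => b k 0 i - a k 0 i)); last first.
    move=> i; rewrite IE lebesgue_measure_itv /= lte_fin.
    case: ltP => [_|ba]; first by rewrite -EFinB.
    by have /eqP-> : b k 0 i == a k 0 i; rewrite ?subrr // eq_le ba ab.
  over.
apply=> //.
  by move=> m i; rewrite /J; exact: measurable_itv.
  by move=> k i; rewrite /I; exact: measurable_itv.
move=> x; pose y : 'rV[R]_n := \row_i x i.
pose inJ (m : {ffun 'I_n -> 'I_M}) :=
  [forall i : 'I_n, (cell_lo R m 0 i <= x i < cell_hi R m 0 i)].
have JindE m : (\prod_(i < n) (\1_(J m i) (x i))%:E = (inJ m)%:R%:E :> \bar R)%E.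
  rewrite prodEFin; congr _%:E.
  have [/forallP xm|] := boolP (inJ m).
    apply: big1 => i _; rewrite JE indicE mem_set //= in_itv /=; exact: xm.
  rewrite /inJ negb_forall => /existsP[i xi].
  rewrite (bigD1 i) //= JE indicE memNset ?mul0r //= in_itv /=; exact/negP.
under eq_bigr => m _ do rewrite JindE.
have term0 k : (0 <= 1 * \prod_(i < n) (\1_(I k i) (x i))%:E :> \bar R)%E.
  by rewrite mul1e prodEFin lee_fin prodr_ge0// => i _; rewrite indicE ler0n.
have [[m /andP[mG xm]]|noG] := pselect (exists m, (m \in G) && inJ m); last first.
  rewrite big1 ?nneseries_ge0// => m _.
  case mG : (m \in G); last by rewrite mul0e.
  case xm : (inJ m); last by rewrite mule0.
  by case: noG; exists m; rewrite mG.
have yA : A y.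
  apply: (GA m) => // i; have /andP[lo hi] := forallP xm i.
  by rewrite [y 0 i]mxE lo ltW.
have [k _ yk] := Aab _ yA.
have kE : (1 * \prod_(i < n) (\1_(I k i) (x i))%:E = 1 :> \bar R)%E.
  rewrite mul1e prodEFin big1// => i _.
  rewrite indicE IE mem_set //= in_itv /=.
  by have := yk i; rewrite mxE.
rewrite (bigD1 m)//= mG xm mule1 big1 ?adde0; last first.
  move=> m' m'm; case xm' : (inJ m'); last by rewrite mule0.
  case/eqP: m'm; apply/ffunP => i; apply/val_inj/eqP; rewrite eqn_leq.
  have /andP[] := forallP xm i; have /andP[] := forallP xm' i.
  rewrite !mxE !ler_pdivrMr// !ltr_pdivlMr// => l1 h1 l2 h2.
  rewrite -ltnS -(ltr_nat R) (le_lt_trans l1 h2) /=.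
  by rewrite -ltnS -(ltr_nat R) (le_lt_trans l2 h1).
rewrite (@nneseries_split _ _ 0 k.+1)// add0n big_mkord big_ord_recr /= kE.
apply: le_trans (leeDl _ _); last exact: nneseries_ge0.
by apply: leeDr; exact: sume_ge0.
Qed.

(** * Rounded scores and their spread along a line *)

Lemma card_window (M L : nat) (A : {set 'I_M}) :
  {in A &, forall a a' : 'I_M, (a' - a <= L)%N} -> (#|A| <= L.+1)%N.
Proof.
move=> AL; have [->|[a0 a0A]] := set_0Vmem A; first by rewrite cards0.
case: (arg_minnP (fun a : 'I_M => val a) a0A) => a aA amin.
rewrite -[X in (_ <= X)%N]card_ord.
rewrite -(@card_in_imset _ _ (fun b : 'I_M => inord (b - a) : 'I_L.+1)).
  exact: max_card.
move=> b b' bA b'A /(congr1 val) /=.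
rewrite !inordK ?ltnS ?AL // => eq_b; apply/val_inj => /=.
by rewrite -(subnK (amin _ bA)) eq_b subnK // amin.
Qed.

Definition upd (n M : nat) (m : {ffun 'I_n -> 'I_M}) (j : 'I_n) (a : 'I_M) :
  {ffun 'I_n -> 'I_M} := [ffun i => if i == j then a else m i].

(** The number of pairs (m, a) with m in B is unchanged when m is replaced by
upd m j a, because (m, a) |-> (upd m j a, m j) is an involution. *)
Lemma card_le_fibers (n M K : nat) (B : {set {ffun 'I_n -> 'I_M}}) (j : 'I_n) :
  (forall m, (#|[set a | upd m j a \in B]%SET| <= K)%N) ->
  (#|B| * M <= K * M ^ n)%N.
Proof.
move=> BK; pose sw (t : {ffun 'I_n -> 'I_M} * 'I_M) := (upd t.1 j t.2, t.1 j).
have swK : involutive sw.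
  case=> m a; rewrite /sw /=; congr pair; last by rewrite ffunE eqxx.
  by apply/ffunP => i; rewrite !ffunE; case: eqP => [->|].
have -> : (#|B| * M = \sum_m \sum_a (upd m j a \in B))%N.
  transitivity (\sum_m \sum_(a < M) (m \in B))%N.
    under [RHS]eq_bigr => m _ do rewrite sum_nat_const card_ord.
    by rewrite -big_distrr mulnC -sum1_card [in LHS]big_mkcond.
  by rewrite !pair_bigA /= (reindex_inj (can_inj swK)).
rewrite -[(M ^ n)%N](_ : #|{: {ffun 'I_n -> 'I_M}}| = _); last first.
  by rewrite card_ffun !card_ord.
rewrite mulnC -sum_nat_const leq_sum // => m _.
rewrite (leq_trans _ (BK m))// -sum1_card [leqRHS]big_mkcond leq_sum //.
by move=> a _; rewrite inE; case: (_ \in B).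
Qed.

(** The squared distance between c and the left end of the a-th of M pieces of
[0, 1], in units of 1/M and rounded down. *)
Definition score1 (R : realType) (M : nat) (c : R) (a : nat) : nat :=
  Num.truncn (M%:R * (a%:R / M%:R - c) ^+ 2).

Definition score (R : realType) (n M : nat) (C : 'rV[R]_n)
    (m : {ffun 'I_n -> 'I_M}) : nat :=
  (\sum_i score1 M (C 0%R i) (m i))%N.

Lemma score1_itv (R : realType) (M : nat) (c : R) (a : nat) :
  (score1 M c a)%:R <= M%:R * (a%:R / M%:R - c) ^+ 2 < (score1 M c a)%:R + 1.
Proof.
by rewrite natr1; apply: truncn_itv; rewrite mulr_ge0 // sqr_ge0.
Qed.

(** Moving x inside its piece changes (x - c)^2 by at most (2 p + 1) / M, and
rounding down costs one more unit. *)
Lemma score1_close (R : realType) (M a : nat) (c p x : R) :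
  (a < M)%N -> `|c - 2^-1| <= p -> a%:R / M%:R <= x <= a.+1%:R / M%:R ->
  `|M%:R * (x - c) ^+ 2 - (score1 M c a)%:R| <= 2 * p + 2.
Proof.
move=> aM; rewrite ler_norml => /andP[cp1 cp2].
have M0 : 0 < M%:R :> R by rewrite ltr0n (leq_ltn_trans _ aM).
have := score1_itv M c a; set s := _%:R; set y := _ / _.
rewrite -natr1 mulrDl -/y mul1r => /andP[s1 s2] /andP[yx xy].
have y0 : 0 <= y by rewrite /y divr_ge0.
have y1 : y + M%:R^-1 <= 1.
  rewrite /y -[X in _ + X]mul1r -mulrDl natr1 ler_pdivrMr // mul1r ler_nat.
  exact: aM.
pose t := M%:R * (x - y).
have t0 : 0 <= t by rewrite /t mulr_ge0 ?subr_ge0 // ltW.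
have t1 : t <= 1.
  by rewrite /t mulrC -ler_pdivlMr // mul1r lerBlDl.
have E : M%:R * (x - c) ^+ 2 = M%:R * (y - c) ^+ 2 + t * (x + y - 2 * c).
  by rewrite /t; ring.
rewrite E ler_norml; apply/andP; split.
  have : - (2 * p + 1) <= t * (x + y - 2 * c) by nra.
  lra.
have : t * (x + y - 2 * c) <= 2 * p + 1 by nra.
lra.
Qed.

(** On [0, 1] the function y |-> (y - c)^2 is monotone with slope at least 2 d
in absolute value; the rounding costs one unit. *)
Lemma score1_spread (R : realType) (M a a' : nat) (c d : R) :
  (a <= a' < M)%N -> 0 <= d -> c <= - d \/ 1 + d <= c ->
  2 * d * (a' - a)%:R <= `|(score1 M c a')%:R - (score1 M c a)%:R| + 1.
Proof.
move=> /andP[aa' a'M] d0 cd.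
have M0 : 0 < M%:R :> R by rewrite ltr0n (leq_ltn_trans _ a'M).
have := score1_itv M c a; have := score1_itv M c a'.
set s := _%:R; set s' := (score1 M c a)%:R; set y' := a'%:R / _; set y := _ / _.
move=> /andP[s1 s2] /andP[s3 s4].
have y0 : 0 <= y by rewrite /y divr_ge0.
have yy' : y <= y' by rewrite ler_wpM2r ?invr_ge0 // ler_nat.
have y1 : y' <= 1 by rewrite ler_pdivrMr // mul1r ler_nat ltnW.
have -> : (a' - a)%:R = M%:R * (y' - y) :> R.
  by rewrite natrB // -mulrBl mulrC divfK // gt_eqF.
set t := M%:R * (y' - y).
have t0 : 0 <= t by rewrite /t mulr_ge0 ?subr_ge0 // ltW.
have E : M%:R * (y' - c) ^+ 2 = M%:R * (y - c) ^+ 2 + t * (y' + y - 2 * c).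
  by rewrite /t; ring.
case: cd => cd.
  have h : 2 * d * t <= t * (y' + y - 2 * c) by nra.
  apply: (@le_trans _ _ (s - s' + 1)); first lra.
  by rewrite lerD2r ler_norm.
have h : 2 * d * t <= - (t * (y' + y - 2 * c)) by nra.
apply: (@le_trans _ _ (s' - s + 1)); first lra.
by rewrite lerD2r distrC ler_norm.
Qed.

(** * Error of the grid approximation *)

Definition sqdist (R : realType) (n : nat) (x C : 'rV[R]_n) : R :=
  \sum_i (x 0 i - C 0 i) ^+ 2.

Lemma sqdist_ge0 (R : realType) (n : nat) (x C : 'rV[R]_n) : 0 <= sqdist x C.
Proof. by apply: sumr_ge0 => i _; exact: sqr_ge0. Qed.

Lemma enorm_sqdist (R : realType) (n : nat) (x C : 'rV[R]_n) :
  enorm (x - C) = Num.sqrt (sqdist x C).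
Proof.
by congr Num.sqrt; apply: eq_bigr => i _; rewrite !mxE.
Qed.

(** Squares avoid the square root in all later estimates. *)
Lemma closed_eballP (R : realType) (n : nat) (x C : 'rV[R]_n) (r : R) :
  0 < r -> (closed_eball C r x : Prop) <-> sqdist x C <= r ^+ 2.
Proof.
move=> r0; rewrite /closed_eball /= enorm_sqdist.
by rewrite -[X in _ <= X]ger0_norm ?(ltW r0) // -sqrtr_sqr ler_sqrt ?sqr_ge0.
Qed.

Lemma center_sqdist_le (R : realType) (n : nat) (C : 'rV[R]_n) (p : R) :
  enorm (C - 2^-1 *: const_mx 1) <= p -> \sum_i (C 0 i - 2^-1) ^+ 2 <= p ^+ 2.
Proof.
rewrite enorm_sqdist => Cp.
have p0 : 0 <= p := le_trans (sqrtr_ge0 _) Cp.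
have -> : \sum_i (C 0 i - 2^-1) ^+ 2 = sqdist C (2^-1 *: const_mx 1).
  by apply: eq_bigr => i _; rewrite !mxE mulr1.
rewrite -[leLHS]sqr_sqrtr ?sqdist_ge0 //.
by rewrite ler_pXn2r // nnegrE sqrtr_ge0.
Qed.

Lemma center_coord_le (R : realType) (n : nat) (C : 'rV[R]_n) (p : R) i :
  enorm (C - 2^-1 *: const_mx 1) <= p -> `|C 0 i - 2^-1| <= p.
Proof.
move=> Cp; have p0 : 0 <= p by apply: le_trans Cp; exact: sqrtr_ge0.
rewrite -(ger0_norm p0) -[leLHS]sqrtr_sqr -[leRHS]sqrtr_sqr.
rewrite ler_sqrt ?sqr_ge0 //; apply: le_trans (center_sqdist_le Cp).
by rewrite (bigD1 i)//= lerDl sumr_ge0 // => k _; exact: sqr_ge0.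
Qed.

(** Otherwise the point of the cube nearest to C would be closer than 1/n in
every coordinate, hence at distance less than 1. *)
Lemma far_coord (R : realType) (n : nat) (C : 'rV[R]_n) :
  (0 < n)%N -> (forall x, unit_cube R n x -> 1 <= enorm (x - C)) ->
  exists j, C 0 j <= - n%:R^-1 \/ 1 + n%:R^-1 <= C 0 j.
Proof.
move=> n0 farC; apply: contrapT => noj.
have n0' : 0 < n%:R :> R by rewrite ltr0n.
have d0 : 0 < n%:R^-1 :> R by rewrite invr_gt0.
have near j : - n%:R^-1 < C 0 j < 1 + n%:R^-1.
  by apply/andP; split; rewrite ltNge; apply/negP => h; apply: noj; exists j;
     [left|right].
(* The projection of C on the cube. *)
pose x : 'rV[R]_n := \row_i
  (if 1 < C 0 i then 1 else if 0 < C 0 i then C 0 i else 0).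
have xU : unit_cube R n x.
  move=> i; rewrite !mxE; case: ltP => c1; first lra.
  by case: ltP => c0; lra.
have := farC _ xU; rewrite enorm_sqdist leNgt => /negP; apply.
rewrite -[X in _ < X]sqrtr1 ltr_sqrt //.
apply: (@lt_le_trans _ _ (\sum_(i < n) n%:R^-1 ^+ 2)).
  apply: ltr_sum => [|i _].
    by apply/hasP; exists (Ordinal n0) => //; rewrite mem_index_enum.
  have /andP[h1 h2] := near i.
  rewrite !mxE -[ltLHS]real_normK ?num_real // ltr_pXn2r ?nnegrE ?(ltW d0) //.
  rewrite ltr_norml.
  case: (ltP 1 (C 0 i)) => c1; first by apply/andP; split; lra.
  by case: (ltP 0 (C 0 i)) => c0; apply/andP; split; lra.
rewrite sumr_const card_ord -[_ *+ n]mulr_natl expr2 mulrA divff ?gt_eqF // mul1r.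
by rewrite invf_le1 // ler1n.
Qed.

Lemma score_close (R : realType) (n M : nat) (C x : 'rV[R]_n) (p : R)
    (m : {ffun 'I_n -> 'I_M}) :
  (forall i, `|C 0 i - 2^-1| <= p) -> cell R n M m x ->
  `|M%:R * sqdist x C - (score C m)%:R| <= n%:R * (2 * p + 2).
Proof.
move=> Cp mx; rewrite /score /sqdist natr_sum mulr_sumr -sumrB.
apply: le_trans (ler_norm_sum _ _ _) _.
rewrite -[n in leRHS]card_ord -sumr_const mulr_suml ler_sum // => i _.
by rewrite mul1r; apply: score1_close => //; have := mx i; rewrite !mxE.
Qed.

(** The cells whose acceptance may be altered by the rounding; the tolerance
is the one of score_close. *)
Definition near_sphere (R : realType) (n M : nat) (C : 'rV[R]_n) (r p : R) :
  {set {ffun 'I_n -> 'I_M}} :=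
  [set m | `|(score C m)%:R - M%:R * r ^+ 2| <= n%:R * (2 * p + 2)]%SET.

(** On a line parallel to the axis j given by far_coord, two cells of the set
have scores differing by at most 2 n (2 p + 2), so by score1_spread their
indices differ by at most n (2 n (2 p + 2) + 1) / 2, which is at most B/2 - 1. *)
Lemma card_near_sphere (R : realType) (n M B : nat) (C : 'rV[R]_n) (r p : R) :
  (0 < n)%N -> (forall x, unit_cube R n x -> 1 <= enorm (x - C)) ->
  0 <= p -> 4 * n%:R ^+ 2 * (p + 1) + n%:R + 2 <= B%:R ->
  (2 * (#|near_sphere M C r p| * M) <= B * M ^ n)%N.
Proof.
move=> n0 farC p0 leB; have [j Cj] := far_coord n0 farC.
have n0' : 1 <= n%:R :> R by rewrite ler1n.
have B2 : (2 <= B)%N.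
  rewrite -(ler_nat R); apply: le_trans leB.
  by rewrite lerDr addr_ge0 // mulr_ge0 ?mulr_ge0 ?sqr_ge0 // addr_ge0.
(* The window has length B/2 - 1, hence at most B/2 elements. *)
suff : (#|near_sphere M C r p| * M <= ((B - 2)./2).+1 * M ^ n)%N.
  have : (2 * ((B - 2)./2).+1 <= B)%N by lia.
  by move=> h1 h2; nia.
apply: (card_le_fibers (j := j)) => m; apply: card_window => a a'.
rewrite !inE => ha ha'.
have [aa'|/ltnW] := leqP a a'; last by rewrite -subn_eq0 => /eqP->.
have spread : 2 * n%:R^-1 * (a' - a)%:R
    <= `|(score1 M (C 0 j) a')%:R - (score1 M (C 0 j) a)%:R| + 1 :> R.
  by apply: score1_spread; rewrite ?aa' ?ltn_ord ?invr_ge0.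
have scoreE b : (score C (upd m j b))%:R
    = (score1 M (C 0 j) b)%:R
      + (\sum_(i < n | i != j) score1 M (C 0%R i) (m i))%:R :> R.
  rewrite /score (bigD1 j) //= ffunE eqxx natrD; congr (_ + _%:R).
  by apply: eq_bigr => i /negbTE ij; rewrite ffunE ij.
move: ha ha'; rewrite !scoreE; set S := (\sum_(i < n | _) _)%:R.
rewrite !ler_norml => /andP[h1 h2] /andP[h3 h4].
have gap : `|(score1 M (C 0 j) a')%:R - (score1 M (C 0 j) a)%:R|
    <= 2 * (n%:R * (2 * p + 2)) :> R.
  by rewrite ler_norml; apply/andP; split; lra.
have {spread}gap : 2 * (a' - a)%:R <= n%:R * (2 * (n%:R * (2 * p + 2)) + 1) :> R.
  rewrite -ler_pdivrMl ?(lt_le_trans _ n0') // [leLHS]mulrCA [leLHS]mulrA.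
  by apply: le_trans spread _; rewrite lerD2r.
have : (2 * (a' - a) + 2)%:R <= B%:R :> R.
  by rewrite natrD natrM; apply: le_trans leB; rewrite -lerBrDr; nra.
by rewrite ler_nat; lia.
Qed.

Lemma cube_in_cell (R : realType) (n M : nat) (x : 'rV[R]_n) :
  (0 < M)%N -> unit_cube R n x ->
  exists m : {ffun 'I_n -> 'I_M}, cell R n M m x.
Proof.
move=> M0 xU; have M0' : 0 < M%:R :> R by rewrite ltr0n.
have Mp i : (minn (Num.truncn (M%:R * x 0%R i)) M.-1 < M)%N.
  by rewrite gtn_min prednK ?leqnn ?orbT.
(* The minimum puts the face x_i = 1 into the last cell. *)
exists [ffun i => Ordinal (Mp i)] => i; rewrite !mxE ffunE /=.
have := xU i; rewrite !mxE => /andP[x0 x1].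
have Mx0 : 0 <= M%:R * x 0 i by rewrite mulr_ge0 // ltW.
have /andP[t1 t2] := truncn_itv Mx0.
rewrite ler_pdivrMr // ler_pdivlMr // [x 0 i * _]mulrC.
rewrite (le_trans _ t1) ?ler_nat ?geq_minl //=.
case: (leqP (Num.truncn (M%:R * x 0 i)) M.-1) => _; first exact: ltW.
by rewrite prednK // -[leRHS]mulr1 ler_pM2l.
Qed.

Definition accepted_cells (R : realType) (n M : nat) (C0 C1 : 'rV[R]_n)
    (r0 r1 : R) : {set {ffun 'I_n -> 'I_M}} :=
  [set m | ((score C0 m)%:R <= M%:R * r0 ^+ 2)
           && ((score C1 m)%:R <= M%:R * r1 ^+ 2)]%SET.

(** Every point of A lies in an accepted cell or in a cell near a sphere, and
every accepted cell away from both spheres is contained in A. So the error is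
at most the proportion of cells near a sphere, which card_near_sphere bounds by
B / M = 1 / D. *)
Lemma vol_approx (R : realType) (n D B : nat) (C0 C1 : 'rV[R]_n)
    (r0 r1 delta p : R) :
  let M := (B * D)%N in
  (1 <= n)%N -> 0 < r0 -> 0 < r1 -> (0 < D)%N -> 1 <= D%:R * delta ->
  (forall x, unit_cube R n x -> 1 <= enorm (x - C0)) ->
  (forall x, unit_cube R n x -> 1 <= enorm (x - C1)) ->
  enorm (C0 - 2^-1 *: const_mx 1) <= p ->
  enorm (C1 - 2^-1 *: const_mx 1) <= p ->
  4 * n%:R ^+ 2 * (p + 1) + n%:R + 2 <= B%:R ->
  (`|(#|accepted_cells M C0 C1 r0 r1|%:R / M%:R ^+ n)%:E
     - vol (unit_cube R n `&` closed_eball C0 r0 `&` closed_eball C1 r1)|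
   <= delta%:E)%E.
Proof.
move=> M n0 r00 r10 D0 Dd far0 far1 Cp0 Cp1 leB.
set S := accepted_cells _ _ _ _ _.
set A := _ `&` _.
have p0 : 0 <= p by apply: le_trans Cp0; exact: sqrtr_ge0.
have B0 : (0 < B)%N.
  rewrite -(ltr_nat R); apply: lt_le_trans leB.
  by rewrite ltr_wpDl // addr_ge0 // mulr_ge0 ?mulr_ge0 ?sqr_ge0 // addr_ge0.
have M0 : (0 < M)%N by rewrite muln_gt0 B0.
have M0' : 0 < M%:R :> R by rewrite ltr0n.
have c0 i : `|C0 0 i - 2^-1| <= p by exact: center_coord_le.
have c1 i : `|C1 0 i - 2^-1| <= p by exact: center_coord_le.
pose N0 := near_sphere M C0 r0 p; pose N1 := near_sphere M C1 r1 p.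
have up x : A x -> exists2 m, m \in (S :|: (N0 :|: N1))%SET & cell R n M m x.
  move=> [[xU /(closed_eballP _ _ r00) x0] /(closed_eballP _ _ r10) x1].
  (* A cell containing a point of both balls is accepted unless a score
     exceeds its threshold by at most the tolerance. *)
  have [m mx] := cube_in_cell M0 xU; exists m => //.
  have := score_close c0 mx; have := score_close c1 mx.
  rewrite !inE !ler_norml => /andP[h1 h2] /andP[h3 h4].
  have k0 : M%:R * sqdist x C0 <= M%:R * r0 ^+ 2 by rewrite ler_pM2l.
  have k1 : M%:R * sqdist x C1 <= M%:R * r1 ^+ 2 by rewrite ler_pM2l.
  case: (leP (score C0 m)%:R) => l0 /=; last first.
    by apply/orP; left; apply/andP; split; lra.
  case: (leP (score C1 m)%:R) => l1 //=.
  by apply/orP; right; apply/andP; split; lra.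
have dn m x : m \in (S :\: (N0 :|: N1))%SET -> cell R n M m x -> A x.
  rewrite !inE !negb_or => /andP[/andP[/negP m0 /negP m1] /andP[s0 s1]] mx.
  have := score_close c0 mx; have := score_close c1 mx.
  rewrite !ler_norml => /andP[h1 h2] /andP[h3 h4].
  have k0 : sqdist x C0 <= r0 ^+ 2.
    rewrite leNgt; apply/negP => lt; apply: m0.
    have : M%:R * r0 ^+ 2 < M%:R * sqdist x C0 by rewrite ltr_pM2l.
    by move=> lt'; rewrite ler_norml; apply/andP; split; lra.
  have k1 : sqdist x C1 <= r1 ^+ 2.
    rewrite leNgt; apply/negP => lt; apply: m1.
    have : M%:R * r1 ^+ 2 < M%:R * sqdist x C1 by rewrite ltr_pM2l.
    by move=> lt'; rewrite ler_norml; apply/andP; split; lra.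
  split; last by apply/closed_eballP.
  split; last by apply/closed_eballP.
  move=> i; have := mx i; rewrite !mxE => /andP[l u].
  rewrite (le_trans _ l) ?divr_ge0 //= (le_trans u) //.
  by rewrite ler_pdivrMr // mul1r ler_nat.
have volU := vol_le_cells n0 up; have volL := vol_ge_cells M0 dn.
have Mn0 : 0 < M%:R ^+ n :> R by rewrite exprn_gt0.
have small : #|(N0 :|: N1)%SET|%:R / M%:R ^+ n <= delta.
  have k0 := card_near_sphere M r0 n0 far0 p0 leB.
  have k1 := card_near_sphere M r1 n0 far1 p0 leB.
  have : (#|(N0 :|: N1)%SET| * M <= B * M ^ n)%N.
    have := leq_of_leqif (leq_card_setU N0 N1); rewrite -/N0 -/N1 in k0 k1.
    by nia.
  rewrite /M mulnA [(_ * B)%N]mulnC -mulnA leq_pmul2l // -/M => k.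
  have kR : #|(N0 :|: N1)%SET|%:R * D%:R <= M%:R ^+ n :> R.
    by rewrite -natrM -natrX ler_nat.
  have delta0 : 0 <= delta.
    have D0' : 0 < D%:R :> R by rewrite ltr0n.
    nra.
  rewrite ler_pdivrMr //.
  have := ler_wpM2r delta0 kR.
  have : 0 <= #|(N0 :|: N1)%SET|%:R :> R by [].
  nra.
have U : #|(S :|: (N0 :|: N1))%SET|%:R / M%:R ^+ n
    <= #|S|%:R / M%:R ^+ n + delta.
  apply: le_trans (lerD (lexx _) small).
  rewrite -mulrDl ler_wpM2r ?invr_ge0 ?(ltW Mn0) // -natrD ler_nat.
  exact: leq_card_setU.
have L : #|S|%:R / M%:R ^+ n - delta
    <= #|(S :\: (N0 :|: N1))%SET|%:R / M%:R ^+ n.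
  rewrite lerBlDr; apply: le_trans (lerD (lexx _) small).
  rewrite -mulrDl ler_wpM2r ?invr_ge0 ?(ltW Mn0) // -natrD ler_nat.
  rewrite -[leqLHS](cardsID (N0 :|: N1)%SET) addnC leq_add2l.
  by rewrite subset_leq_card // subsetIr.
move: volU volL; case: (vol A) => [v| |]; rewrite ?leNye_eq ?leye_eq //.
rewrite !lee_fin => vU vL; rewrite ler_norml.
by apply/andP; split; lra.
Qed.

(** * Resource-bounded correctness of programs *)

Local Notation eval := Defs.eval.

Fixpoint wvars (p : prog) : seq nat :=
  match p with
  | Skip | Put _ _ _ => [::]
  | Assign x _ => [:: x]
  | Seq p1 p2 | If _ _ _ p1 p2 => wvars p1 ++ wvars p2
  | While _ _ _ p1 => wvars p1
  end.

Fixpoint warrs (p : prog) : seq nat :=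
  match p with
  | Skip | Assign _ _ => [::]
  | Put a _ _ => [:: a]
  | Seq p1 p2 | If _ _ _ p1 p2 => warrs p1 ++ warrs p2
  | While _ _ _ p1 => warrs p1
  end.

Definition frame (R : realType) (p : prog) (s s' : state R) : Prop :=
  (forall x, x \notin wvars p -> vars s' x = vars s x)
  /\ (forall a, a \notin warrs p -> arrs s' a = arrs s a).

(** What a program does not write syntactically is left unchanged; loop
invariants then only need to speak of what the loop modifies. *)
Lemma exec_frame (R : realType) (p : prog) (s s' : state R) (k : nat) :
  exec p s s' k -> frame p s s'.
Proof.
elim=> {p s s' k} //.
- move=> s x e v _; split=> // y; rewrite inE /= => /negbTE yx.
  by rewrite yx.
- move=> s a ei e i k v _ _ _; split=> // b; rewrite inE /= => /negbTE ba.
  by apply/funext => j; rewrite ba.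
- move=> p1 p2 s1 s2 s3 k1 k2 _ [v1 a1] _ [v2 a2]; split=> [x|a] /=;
    rewrite mem_cat negb_or => /andP[h1 h2].
  + by rewrite v2 // v1.
  + by rewrite a2 // a1.
- move=> o e1 e2 p1 p2 s s' v1 v2 k _ _ _; case: ifP => _ [fv fa];
    split=> [x|a] /=; rewrite mem_cat negb_or => /andP[h1 h2];
    by rewrite ?fv ?fa.
- move=> o e1 e2 p s s' s'' v1 v2 k k' _ _ _ _ [fv1 fa1] _ [fv2 fa2].
  split=> [x|a] /= h.
  + by rewrite fv2 // fv1.
  + by rewrite fa2 // fa1.
Qed.

(** Total correctness with a cost bound. *)
Definition runs (R : realType) (p : prog) (s : state R) (c : nat)
    (Post : state R -> Prop) : Prop :=
  exists s' k, [/\ exec p s s' k, (k <= c)%N & Post s'].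

Lemma runs_weaken (R : realType) p (s : state R) c c'
    (Post Post' : state R -> Prop) :
  runs p s c Post -> (c <= c')%N -> (forall s', Post s' -> Post' s') ->
  runs p s c' Post'.
Proof.
move=> [s' [k [ex kc Ps']]] cc' PP'; exists s', k; split=> //.
- exact: leq_trans cc'.
- exact: PP'.
Qed.

Lemma runs_frame (R : realType) p (s : state R) c (Post : state R -> Prop) :
  runs p s c Post -> runs p s c (fun s' => Post s' /\ frame p s s').
Proof.
move=> [s' [k [ex kc Ps']]]; exists s', k; split=> //; split=> //.
exact: exec_frame ex.
Qed.

Lemma runs_skip (R : realType) (s : state R) (Post : state R -> Prop) :
  Post s -> runs Skip s 0 Post.
Proof. by move=> Ps; exists s, 0%N; split=> //; exact: ExecSkip. Qed.

Lemma runs_assign (R : realType) x e v (s : state R) (Post : state R -> Prop) :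
  eval s e = Some v -> Post (set_var s x v) -> runs (Assign x e) s (cost e) Post.
Proof.
by move=> ev Ps; exists (set_var s x v), (cost e); split=> //; exact: ExecAssign.
Qed.

Lemma runs_put (R : realType) a ei e k v (s : state R)
    (Post : state R -> Prop) :
  eval s ei = Some k%:R -> eval s e = Some v -> Post (set_arr s a k v) ->
  runs (Put a ei e) s (cost ei + cost e) Post.
Proof.
move=> evi ev Ps; exists (set_arr s a k v), (cost ei + cost e)%N; split=> //.
by apply: ExecPut evi _ ev; rewrite /eval_index natr_nat natrK.
Qed.

Lemma runs_seq (R : realType) p1 p2 (s : state R) c1 c2
    (Mid Post : state R -> Prop) :
  runs p1 s c1 Mid -> (forall s', Mid s' -> runs p2 s' c2 Post) ->
  runs (Seq p1 p2) s (c1 + c2) Post.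
Proof.
move=> [s1 [k1 [ex1 kc1 Ms1]]] /(_ _ Ms1)[s2 [k2 [ex2 kc2 Ps2]]].
by exists s2, (k1 + k2)%N; split=> //; [exact: ExecSeq ex1 ex2|exact: leq_add].
Qed.

Lemma runs_assign_seq (R : realType) x e v p (s : state R) c
    (Post : state R -> Prop) :
  eval s e = Some v -> runs p (set_var s x v) c Post ->
  runs (Seq (Assign x e) p) s (cost e + c) Post.
Proof.
move=> ev h; apply: (runs_seq (Mid := fun s' => s' = set_var s x v)).
  exact: runs_assign ev _.
by move=> _ ->.
Qed.

Lemma runs_if (R : realType) o e1 e2 v1 v2 p1 p2 (s : state R) c
    (Post : state R -> Prop) :
  eval s e1 = Some v1 -> eval s e2 = Some v2 ->
  runs (if eval_cmp o v1 v2 then p1 else p2) s c Post ->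
  runs (If o e1 e2 p1 p2) s ((cost e1 + cost e2).+1 + c) Post.
Proof.
move=> ev1 ev2 [s' [k [ex kc Ps']]].
exists s', ((cost e1 + cost e2).+1 + k)%N; split=> //.
- exact: ExecIf ev1 ev2 ex.
- by rewrite leq_add2l.
Qed.

(** The invariant is indexed by the number of iterations done, and the guard
fails exactly after N of them. *)
Lemma runs_while (R : realType) o e1 e2 p (N c : nat)
    (Inv : nat -> state R -> Prop) (s : state R) :
  let g := (cost e1 + cost e2).+1 in
  (forall j s', (j <= N)%N -> Inv j s' -> exists v1 v2,
     [/\ eval s' e1 = Some v1, eval s' e2 = Some v2
       & eval_cmp o v1 v2 = (j < N)%N]) ->
  (forall j s', (j < N)%N -> Inv j s' -> runs p s' c (Inv j.+1)) ->
  Inv 0%N s -> runs (While o e1 e2 p) s (N * (g + c) + g) (Inv N).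
Proof.
move=> g guard body I0.
suff H d : forall j t, (j + d = N)%N -> Inv j t ->
    runs (While o e1 e2 p) t (d * (g + c) + g) (Inv N) by exact: H I0.
elim: d => [|d IH] j t jdN Ij.
  rewrite addn0 in jdN; subst j.
  have [v1 [v2 [ev1 ev2]]] := guard _ _ (leqnn _) Ij; rewrite ltnn => cf.
  by exists t, g; split=> //; exact: ExecWhileF ev1 ev2 cf.
have jN : (j < N)%N by rewrite -jdN -addSnnS leq_addr.
have [v1 [v2 [ev1 ev2]]] := guard _ _ (ltnW jN) Ij; rewrite jN => ct.
have [t1 [k1 [ex1 kc1 It1]]] := body _ _ jN Ij.
have [|t2 [k2 [ex2 kc2 It2]]] := IH _ _ _ It1; first by rewrite addSnnS.
exists t2, (g + k1 + k2)%N; split=> //; first exact: ExecWhileT ev1 ev2 ct ex1 ex2.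
by rewrite mulSn; lia.
Qed.

Definition nat_cst (k : nat) : expr := Cst k%:R.

Lemma eval_nat_cst (R : realType) (s : state R) k :
  eval s (nat_cst k) = Some k%:R.
Proof. by rewrite /= ratr_nat. Qed.

Lemma eval_addn (R : realType) (s : state R) e1 e2 k1 k2 :
  eval s e1 = Some k1%:R -> eval s e2 = Some k2%:R ->
  eval s (Op Add e1 e2) = Some (k1 + k2)%:R.
Proof. by move=> /= -> ->; rewrite /= natrD. Qed.

Lemma eval_muln (R : realType) (s : state R) e1 e2 k1 k2 :
  eval s e1 = Some k1%:R -> eval s e2 = Some k2%:R ->
  eval s (Op Mul e1 e2) = Some (k1 * k2)%:R.
Proof. by move=> /= -> ->; rewrite /= natrM. Qed.

Lemma eval_get (R : realType) (s : state R) a e k :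
  eval s e = Some k%:R -> eval s (Get a e) = Some (arrs s a k).
Proof. by move=> /= ->; rewrite /= /eval_index natr_nat natrK. Qed.

(** The bound is a variable, so that the evaluation of the guard costs a
single comparison. *)
Definition For (x y : nat) (body : prog) : prog :=
  Seq (Assign x (nat_cst 0))
    (While Lt (Var x) (Var y)
       (Seq body (Assign x (Op Add (Var x) (nat_cst 1))))).

(** The invariant must survive a change of the loop counter, whose value is
supplied separately to the body together with the frame of the whole loop. *)
Lemma runs_for (R : realType) x y body (N c : nat)
    (Inv : nat -> state R -> Prop) (s : state R) :
  y != x -> x \notin wvars body -> y \notin wvars body ->
  vars s y = N%:R ->
  (forall j t v, Inv j t -> Inv j (set_var t x v)) ->
  Inv 0%N s ->
  (forall j t, (j < N)%N -> Inv j t -> vars t x = j%:R ->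
     frame (For x y body) s t -> runs body t c (Inv j.+1)) ->
  runs (For x y body) s (N * (c + 2) + 1) (Inv N).
Proof.
move=> yx xb yb syN stab I0 Hbody.
have ws z : z \notin wvars (For x y body) -> z != x /\ z \notin wvars body.
  rewrite /= inE negb_or mem_cat negb_or => /andP[zx /andP[zb _]].
  by split.
apply: (@runs_weaken _ _ _ (cost (nat_cst 0) + (N * (1 + (c + 1)) + 1))%N _
  (fun t => (Inv N t /\ vars t x = N%:R) /\ frame (For x y body) s t)).
- apply: (runs_assign_seq (v := 0)); first by rewrite (eval_nat_cst s 0).
  apply: (@runs_while _ Lt (Var x) (Var y) _ N (c + 1)%N
    (fun j t => (Inv j t /\ vars t x = j%:R) /\ frame (For x y body) s t)).
  + move=> j t jN [[_ tx] [ft _]]; exists j%:R, N%:R; split=> //=.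
    * by rewrite tx.
    * by rewrite ft ?syN //= inE negb_or yx mem_cat negb_or yb inE.
    * by rewrite ltr_nat.
  + move=> j t jN [[Ij tx] ft].
    apply: runs_seq (runs_frame (Hbody j t jN Ij tx ft)) _ => t' [Ij' [fv fa]].
    apply: (runs_assign (v := j.+1%:R)).
      by rewrite -[j.+1]addn1; apply: eval_addn; rewrite ?eval_nat_cst //= fv // tx.
    split; first by split; [exact: stab|rewrite /= eqxx].
    split=> [z /ws [zx zb]|a] /=.
      rewrite (negbTE zx) fv // ft.1 //= inE negb_or zx mem_cat negb_or zb.
      by rewrite inE.
    by rewrite cats0 => ab; rewrite fa // ft.2 //= cats0.
  + split; first by split; [exact: stab|rewrite /= eqxx].
    by split=> //= z /ws [/negbTE zx _]; rewrite zx.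
- by rewrite /= add0n addnC; lia.
- by move=> t [[]].
Qed.

(** The machine has no rounding operation, so the integer part is found by
counting, which is affordable because only polynomially large numbers are
rounded. *)
Definition Floor (x y : nat) : prog :=
  Seq (Assign x (nat_cst 0))
    (While Le (Op Add (Var x) (nat_cst 1)) (Var y)
       (Assign x (Op Add (Var x) (nat_cst 1)))).

Lemma runs_floor (R : realType) x y (s : state R) :
  y != x ->
  runs (Floor x y) s (3 * Num.truncn (vars s y) + 2)
    (fun t => vars t x = (Num.truncn (vars s y))%:R).
Proof.
move=> yx; set N := Num.truncn _.
apply: (@runs_weaken _ _ _ (cost (nat_cst 0) + (N * (2 + 1) + 2))%N _
  (fun t => vars t x = N%:R /\ vars t y = vars s y)); last by move=> t [].
- apply: (runs_assign_seq (v := 0)); first by rewrite (eval_nat_cst s 0).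
  apply: (@runs_while _ Le (Op Add (Var x) (nat_cst 1)) (Var y) _ N 1
    (fun j t => vars t x = j%:R /\ vars t y = vars s y)).
  + move=> j t jN [tx ty]; exists (j + 1)%:R, (vars s y); split.
    * by apply: eval_addn; rewrite ?eval_nat_cst //= tx.
    * by rewrite /= ty.
    * by rewrite /= addn1 -truncn_gt_nat.
  + move=> j t jN [tx ty]; apply: (runs_assign (v := j.+1%:R)).
      by rewrite -[j.+1]addn1; apply: eval_addn; rewrite ?eval_nat_cst //= tx.
    by rewrite /= eqxx (negbTE yx).
  + by rewrite /= eqxx (negbTE yx).
- by rewrite /= add0n mulnC.
Qed.

(** * Filling the table *)

(* The variables 0 to 3 and the arrays 0 and 1 are those of the input. *)
Local Notation vn := 0%N (only parsing).
Local Notation vr0 := 1%N (only parsing).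
Local Notation vr1 := 2%N (only parsing).
Local Notation vdelta := 3%N (only parsing).
Local Notation vD := 4%N (only parsing).
Local Notation vB := 5%N (only parsing).
Local Notation vM := 6%N (only parsing).
Local Notation vW := 7%N (only parsing).
Local Notation vZ := 8%N (only parsing).
Local Notation vi := 9%N (only parsing).
Local Notation va := 10%N (only parsing).
Local Notation ve := 11%N (only parsing).
Local Notation vtmp := 12%N (only parsing).
Local Notation vscore0 := 13%N (only parsing).
Local Notation vscore1 := 14%N (only parsing).
Local Notation vs := 15%N (only parsing).
Local Notation vt := 16%N (only parsing).
Local Notation vout := 17%N (only parsing).
Local Notation atab := 2%N (only parsing).

Definition Score (arr dest : nat) : prog :=
  let d := Op Defs.Sub (Op Div (Var va) (Var vM)) (Get arr (Var vi)) in
  Seq (Assign vtmp (Op Mul (Var vM) (Op Mul d d))) (Floor dest vtmp).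

(** The table is stored row after row: entry e of row i is at i Z + e, with
rows of length Z = W W. *)
Definition src_index : expr := Op Add (Op Mul (Var vi) (Var vZ)) (Var ve).

(** A pair (u, v) of scores is packed as u W + v, so that packing is additive
and adding a coordinate is a shift in the next row. *)
Definition dst_index : expr :=
  Op Add (Op Mul (Op Add (Var vi) (nat_cst 1)) (Var vZ))
    (Op Add (Op Add (Op Mul (Var vscore0) (Var vW)) (Var vscore1)) (Var ve)).

Definition Push : prog :=
  For ve vZ (Put atab dst_index
    (Op Add (Get atab dst_index) (Op Div (Get atab src_index) (Var vM)))).

Definition AddCoordinate : prog :=
  For va vM (Seq (Score 0 vscore0) (Seq (Score 1 vscore1) Push)).

Definition FillTable : prog := For vi vn AddCoordinate.

(** The part of the state that is constant while the table is filled and read. *)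
Definition env (R : realType) (n M W : nat) (c0 c1 : nat -> R) (s : state R) :
    Prop :=
  [/\ vars s vn = n%:R, vars s vM = M%:R, vars s vW = W%:R,
      vars s vZ = (W * W)%:R & arrs s 0%N = c0 /\ arrs s 1%N = c1].

Lemma env_frame (R : realType) n M W (c0 c1 : nat -> R) p (s t : state R) :
  frame p s t ->
  all (fun x => x \notin wvars p) [:: vn; vM; vW; vZ] ->
  all (fun a => a \notin warrs p) [:: 0; 1]%N ->
  env n M W c0 c1 s -> env n M W c0 c1 t.
Proof.
move=> [fv fa] /and5P[h0 h6 h7 h8 _] /and3P[k0 k1 _] [e0 e6 e7 e8 [a0 a1]].
by split; rewrite ?fv ?fa.
Qed.

Lemma runs_score (R : realType) (arr dest M a i : nat) (s : state R) :
  vtmp != dest -> (0 < M)%N -> vars s vM = M%:R -> vars s va = a%:R ->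
  vars s vi = i%:R ->
  let v := score1 M (arrs s arr i) a in
  runs (Score arr dest) s (3 * v + 8) (fun t => vars t dest = v%:R).
Proof.
move=> td M0 sM sa si v.
apply: (@runs_weaken _ _ _ (6 + (3 * v + 2)) _ (fun t => vars t dest = v%:R)) => //.
  apply: (runs_assign_seq (v := M%:R * (a%:R / M%:R - arrs s arr i) ^+ 2)).
    rewrite /= sM sa si /eval_index natr_nat natrK /= pnatr_eq0 eqn0Ngt M0 /=.
    by rewrite expr2.
  by have := @runs_floor _ dest vtmp
    (set_var s vtmp (M%:R * (a%:R / M%:R - arrs s arr i) ^+ 2)) td.
by lia.
Qed.

(** Adds to row i + 1 a copy of row i shifted by w and divided by M, that is
the product of polynomials q * (M^-1 X^w). The loop stops at Z although rows
are compared at all indices: the coefficients of q beyond Z vanish. *)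
Lemma runs_push (R : realType) n M W (c0 c1 : nat -> R) i u v (q r : {poly R})
    (s : state R) :
  let Z := (W * W)%N in
  let w := (u * W + v)%N in
  (0 < M)%N -> env n M W c0 c1 s -> vars s vi = i%:R ->
  vars s vscore0 = u%:R -> vars s vscore1 = v%:R -> (size q <= Z)%N ->
  (forall e, (e < Z)%N -> arrs s atab (i * Z + e)%N = q`_e) ->
  (forall e, arrs s atab (i.+1 * Z + e)%N = r`_e) ->
  runs Push s (Z * 18 + 1) (fun t =>
    (forall e, (e < Z)%N -> arrs t atab (i * Z + e)%N = q`_e)
    /\ (forall e, arrs t atab (i.+1 * Z + e)%N
                  = (r + q * (M%:R^-1 *: 'X^w))`_e)).
Proof.
move=> Z w M0 sE si su sv qZ hq hr.
pose Inv j (t : state R) :=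
  (forall e, (e < Z)%N -> arrs t atab (i * Z + e)%N = q`_e)
  /\ (forall e, arrs t atab (i.+1 * Z + e)%N
       = r`_e + (if (w <= e < w + j)%N then q`_(e - w) / M%:R else 0)).
have sZ : vars s vZ = Z%:R by case: sE.
apply: (@runs_weaken _ _ _ (Z * (16 + 2) + 1) _ (Inv Z)) => //; last first.
  move=> t [h1 h2]; split=> // e; rewrite h2 coefD -scalerAr coefZ coefMXn.
  congr (_ + _); rewrite [in RHS]fun_if mulr0 ltnNge [in RHS]mulrC.
  case: leqP => //= we; case: ltnP => // Ze.
  by rewrite nth_default ?mul0r // (leq_trans qZ) // leq_subRL.
apply: runs_for => //.
  split=> // e; rewrite hr addn0; case: ifP => [|_]; last by rewrite addr0.
  by case/andP => h1 h2; rewrite ltnNge h1 in h2.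
move=> j t jZ [h1 h2] tj tF.
have [tn tM tW tZ _] := env_frame tF isT isT sE.
case: tF => tv _.
have ti : vars t vi = i%:R by rewrite tv.
have tu : vars t vscore0 = u%:R by rewrite tv.
have tv1 : vars t vscore1 = v%:R by rewrite tv.
have evsrc : eval t src_index = Some (i * Z + j)%:R.
  by apply: eval_addn; [apply: eval_muln|]; rewrite /= ?ti ?tZ ?tj.
have evdst : eval t dst_index = Some (i.+1 * Z + (w + j))%:R.
  rewrite -[i.+1]addn1; apply: eval_addn.
    apply: eval_muln; last by rewrite /= tZ.
    by apply: eval_addn; rewrite ?eval_nat_cst //= ti.
  apply: eval_addn; last by rewrite /= tj.
  apply: eval_addn; last by rewrite /= tv1.
  by apply: eval_muln; rewrite /= ?tu ?tW.
apply: (runs_put evdst).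
  apply: (_ : _ = Some (arrs t atab (i.+1 * Z + (w + j))%N + q`_j / M%:R)).
  have := eval_get atab evdst; have := eval_get atab evsrc.
  rewrite (h1 _ jZ) /= tM.
  by move=> -> -> /=; rewrite pnatr_eq0 eqn0Ngt M0.
split=> [e eZ|e] /=.
  rewrite h1 // ifF //; apply/negbTE; rewrite neq_ltn; apply/orP; left.
  by rewrite mulSn; lia.
rewrite eqn_add2l; case: eqP => [->|/eqP ne].
  rewrite h2 ltnn andbF addr0 leq_addr ltn_add2l ltnSn /=.
  by rewrite addKn.
rewrite h2; congr (_ + _); congr (if _ then _ else _).
by rewrite addnS ltnS [(e <= w + j)%N]leq_eqVlt (negbTE ne).
Qed.

Definition weight (R : realType) (M W : nat) (c0 c1 : nat -> R) (i a : nat) :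
  nat := (score1 M (c0 i) a * W + score1 M (c1 i) a)%N.

(** The generating polynomial of the packed score of coordinate i when the
piece is uniform among the first m of M ones; the total mass is m / M. *)
Definition coord_gen (R : realType) (M W : nat) (c0 c1 : nat -> R) (i m : nat) :
  {poly R} := \sum_(a < m) (M%:R^-1 *: 'X^(weight M W c0 c1 i a)).

(** The probability generating polynomial of the packed scores of the first i
coordinates. *)
Definition gen (R : realType) (M W : nat) (c0 c1 : nat -> R) (i : nat) :
  {poly R} := \prod_(j < i) coord_gen M W c0 c1 j M.

Lemma runs_add_coordinate (R : realType) n M W (c0 c1 : nat -> R) i
    (q : {poly R}) (s : state R) :
  let Z := (W * W)%N in
  (0 < M)%N -> env n M W c0 c1 s -> vars s vi = i%:R -> (size q <= Z)%N ->
  (forall a, (a < M)%N -> (score1 M (c0 i) a < W)%N) ->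
  (forall a, (a < M)%N -> (score1 M (c1 i) a < W)%N) ->
  (forall e, arrs s atab (i * Z + e)%N = q`_e) ->
  runs AddCoordinate s (M * (6 * W + 18 * Z + 19) + 1) (fun t =>
    forall e, arrs t atab (i.+1 * Z + e)%N
              = (q * coord_gen M W c0 c1 i M)`_e).
Proof.
move=> Z M0 sE si qZ u0W u1W hq.
pose Inv j (t : state R) :=
  (forall e, (e < Z)%N -> arrs t atab (i * Z + e)%N = q`_e)
  /\ (forall e, arrs t atab (i.+1 * Z + e)%N
       = (q * coord_gen M W c0 c1 i j)`_e).
have [sn sM sW sZ [sc0 sc1]] := sE.
apply: (@runs_weaken _ _ _ (M * (6 * W + 18 * Z + 17 + 2) + 1) _ (Inv M)) => //;
  last 2 first.
- by rewrite -addnA.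
- by move=> t [].
apply: runs_for => //.
  split=> // e; rewrite /coord_gen big_ord0 mulr0 coef0.
  rewrite mulSn [(Z + _)%N]addnC -addnA hq nth_default //.
  by rewrite (leq_trans qZ) // leq_addr.
move=> a t aM [h1 h2] ta tF.
have tE := env_frame tF isT isT sE.
have [tn tM tW tZ [tc0 tc1]] := tE.
have ti : vars t vi = i%:R by rewrite tF.1.
set u := score1 M (c0 i) a; set v := score1 M (c1 i) a.
have uW : (u < W)%N := u0W a aM.
have vW' : (v < W)%N := u1W a aM.
apply: (@runs_weaken _ _ _ ((3 * u + 8) + ((3 * v + 8) + (Z * 18 + 1))) _
  (Inv a.+1)) => //; last by lia.
have /runs_frame := @runs_score _ 0%N vscore0 M a i t isT M0 tM ta ti.
rewrite tc0 -/u => h; apply: (runs_seq h) => t1 [t1u t1F].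
have t1E := env_frame t1F isT isT tE.
have [t1n t1M t1W t1Z [t1c0 t1c1]] := t1E.
have t1a : vars t1 va = a%:R by rewrite t1F.1.
have t1i : vars t1 vi = i%:R by rewrite t1F.1.
have /runs_frame := @runs_score _ 1%N vscore1 M a i t1 isT M0 t1M t1a t1i.
rewrite t1c1 -/v => h'; apply: (runs_seq h') => t2 [t2v t2F].
have t2E := env_frame t2F isT isT t1E.
have t2i : vars t2 vi = i%:R by rewrite t2F.1.
have t2u : vars t2 vscore0 = u%:R by rewrite t2F.1.
have t2t : arrs t2 atab = arrs t atab by rewrite t2F.2 // t1F.2.
apply: runs_weaken; first by
  apply: (runs_push (q := q) (r := q * coord_gen M W c0 c1 i a) M0 t2E t2i t2u t2v);
  rewrite ?t2t.
  by [].
move=> t3 [k1 k2]; split=> // e.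
by rewrite k2 /coord_gen big_ord_recr /= mulrDr.
Qed.

(** Row i holds the coefficients of gen i. The initial table, whose only
nonzero entry is a 1 at index 0, is row 0, and the size bound on gen keeps
the rows from overlapping. *)
Lemma runs_fill_table (R : realType) n M W (c0 c1 : nat -> R) (s : state R) :
  let Z := (W * W)%N in
  (0 < M)%N -> env n M W c0 c1 s ->
  (forall i, (i < n)%N -> (size (gen M W c0 c1 i) <= Z)%N) ->
  (forall i a, (i < n)%N -> (a < M)%N -> (score1 M (c0 i) a < W)%N) ->
  (forall i a, (i < n)%N -> (a < M)%N -> (score1 M (c1 i) a < W)%N) ->
  arrs s atab = (fun k => (k == 0%N)%:R) ->
  runs FillTable s (n * (M * (6 * W + 18 * Z + 19) + 3) + 1) (fun t =>
    forall e, arrs t atab (n * Z + e)%N = (gen M W c0 c1 n)`_e).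
Proof.
move=> Z M0 sE genZ u0W u1W s2.
pose Inv i (t : state R) :=
  forall e, arrs t atab (i * Z + e)%N = (gen M W c0 c1 i)`_e.
have [sn sM sW sZ [sc0 sc1]] := sE.
apply: (@runs_weaken _ _ _ (n * (M * (6 * W + 18 * Z + 19) + 1 + 2) + 1) _
  (Inv n)) => //; last by rewrite -addnA.
apply: runs_for => //.
  by move=> e; rewrite s2 mul0n add0n /gen big_ord0 coef1.
move=> i t iN It ti tF.
have tE := env_frame tF isT isT sE.
apply: runs_weaken.
- by apply: (runs_add_coordinate (q := gen M W c0 c1 i) M0 tE ti) => //;
    [exact: genZ|move=> a; exact: u0W|move=> a; exact: u1W].
- by [].
- by move=> t' h e; rewrite h /gen big_ord_recr.
Qed.

(** * Reading the table *)

Lemma gen_sum (R : realType) M W (c0 c1 : nat -> R) i :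
  gen M W c0 c1 i
  = \sum_(m : {ffun 'I_i -> 'I_M})
      M%:R^-1 ^+ i *: 'X^(\sum_(j < i) weight M W c0 c1 j (m j)).
Proof.
rewrite /gen /coord_gen bigA_distr_bigA; apply: eq_bigr => m _.
rewrite scaler_prod prodr_const card_ord; congr (_ *: _).
by rewrite (big_morph (fun k => 'X^k : {poly R}) (@exprD _ _) (expr0 _)).
Qed.

Lemma sum_weight (R : realType) M W (c0 c1 : nat -> R) i (a : 'I_i -> nat) :
  (\sum_(j < i) weight M W c0 c1 j (a j)
   = (\sum_(j < i) score1 M (c0 j) (a j)) * W
     + \sum_(j < i) score1 M (c1 j) (a j))%N.
Proof. by rewrite big_split /= -big_distrl. Qed.

(** The exponents are u W + v with u, v < W. *)
Lemma size_gen (R : realType) M W (c0 c1 : nat -> R) i :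
  (forall m : {ffun 'I_i -> 'I_M}, \sum_(j < i) score1 M (c0 j) (m j) < W)%N ->
  (forall m : {ffun 'I_i -> 'I_M}, \sum_(j < i) score1 M (c1 j) (m j) < W)%N ->
  (size (gen M W c0 c1 i) <= W * W)%N.
Proof.
move=> h0 h1; apply/leq_sizeP => e We; rewrite gen_sum coef_sum big1 // => m _.
rewrite coefZ coefXn sum_weight.
have := h0 m; have := h1 m.
set u := (\sum_(j < i) _)%N; set v := (\sum_(j < i) _)%N.
move=> uW vW; case: eqP => [ee|_]; last by rewrite mulr0.
by exfalso; move: We; rewrite ee; nia.
Qed.

(** Since |y - 1/2| <= 1/2, one has (y - c)^2 <= 1/2 + 2 (c - 1/2)^2. *)
Lemma score_sum_lt (R : realType) (n M B : nat) (c : nat -> R) (i : nat)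
    (a : 'I_i -> nat) :
  (i <= n)%N -> (0 < M)%N -> (forall j, (a j < M)%N) ->
  \sum_(j < n) (2^-1 + 2 * (c j - 2^-1) ^+ 2) < B%:R ->
  (\sum_(j < i) score1 M (c j) (a j) < M * B)%N.
Proof.
move=> iN M0 aM cB; have M0' : 0 < M%:R :> R by rewrite ltr0n.
rewrite -(ltr_nat R) natrM natr_sum.
apply: (@le_lt_trans _ _ (M%:R * \sum_(j < n) (2^-1 + 2 * (c j - 2^-1) ^+ 2)));
  last by rewrite ltr_pM2l.
rewrite mulr_sumr.
apply: (@le_trans _ _ (\sum_(j < i) M%:R * (2^-1 + 2 * (c j - 2^-1) ^+ 2))).
  apply: ler_sum => j _; have /andP[h _] := score1_itv M (c j) (a j).
  apply: le_trans h _; rewrite ler_pM2l //.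
  have : 0 <= ((a j)%:R / M%:R : R) <= 1.
    by rewrite divr_ge0 // ler_pdivrMr // mul1r ler_nat ltnW.
  set y := _ / _ => /andP[y0 y1]; set d := c j - 2^-1.
  have -> : y - c j = (y - 2^-1) - d by rewrite /d; ring.
  have : 0 <= ((y - 2^-1) + d) ^+ 2 by exact: sqr_ge0.
  nra.
rewrite -!(big_mkord xpredT (fun j => M%:R * (2^-1 + 2 * (c j - 2^-1) ^+ 2))).
rewrite (big_cat_nat (n := i) (p := n)) //= lerDl sumr_ge0 // => j _.
by rewrite mulr_ge0 // addr_ge0 ?invr_ge0 // mulr_ge0 // sqr_ge0.
Qed.

Definition Collect : prog :=
  For vs vW (For vt vW
    (If Le (Var vs) (Op Mul (Var vM) (Op Mul (Var vr0) (Var vr0)))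
      (If Le (Var vt) (Op Mul (Var vM) (Op Mul (Var vr1) (Var vr1)))
        (Assign vout (Op Add (Var vout)
          (Get atab (Op Add (Op Mul (Var vn) (Var vZ))
            (Op Add (Op Mul (Var vs) (Var vW)) (Var vt))))))
        Skip)
      Skip)).

Definition accepted_entry (R : realType) (M W : nat) (r0 r1 : R)
    (q : {poly R}) (s t : nat) : R :=
  if (s%:R <= M%:R * r0 ^+ 2) && (t%:R <= M%:R * r1 ^+ 2)
  then q`_(s * W + t) else 0.

Lemma runs_collect (R : realType) n M W (c0 c1 : nat -> R) (r0 r1 : R)
    (q : {poly R}) (st : state R) :
  env n M W c0 c1 st -> vars st vr0 = r0 -> vars st vr1 = r1 ->
  vars st vout = 0 ->
  (forall e, arrs st atab (n * (W * W) + e)%N = q`_e) ->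
  runs Collect st (W * (W * 13 + 3) + 1) (fun t =>
    vars t vout
    = \sum_(s < W) \sum_(t < W) accepted_entry M W r0 r1 q s t).
Proof.
move=> stE st0 st1 stout hq.
have [stn stM stW stZ _] := stE.
pose Inv j (t : state R) := vars t vout
  = \sum_(s < j) \sum_(t < W) accepted_entry M W r0 r1 q s t.
apply: (@runs_weaken _ _ _ (W * (W * (11 + 2) + 1 + 2) + 1) _ (Inv W)) => //;
  last by rewrite -addnA.
apply: runs_for => //; first by rewrite /Inv big_ord0.
move=> s t sW It ts tF.
have tE := env_frame tF isT isT stE.
have [tn tM tW tZ _] := tE.
have t0 : vars t vr0 = r0 by rewrite tF.1.
have t1 : vars t vr1 = r1 by rewrite tF.1.
have tT : arrs t atab = arrs st atab by rewrite tF.2.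
pose Inv' j (t' : state R) := vars t' vout = vars t vout
  + \sum_(t < j) accepted_entry M W r0 r1 q s t.
apply: (@runs_weaken _ _ _ (W * (11 + 2) + 1) _ (Inv' W)) => //; last first.
  by move=> t' It'; rewrite /Inv big_ord_recr /= It' It.
apply: runs_for => //; first by rewrite /Inv' big_ord0 addr0.
move=> j t' jW It' t'j t'F.
have t'E := env_frame t'F isT isT tE.
have [t'n t'M t'W t'Z _] := t'E.
have t'0 : vars t' vr0 = r0 by rewrite t'F.1.
have t'1 : vars t' vr1 = r1 by rewrite t'F.1.
have t's : vars t' vs = s%:R by rewrite t'F.1.
have t'T : arrs t' atab = arrs st atab by rewrite t'F.2.
have evidx : eval t' (Op Add (Op Mul (Var vn) (Var vZ))
      (Op Add (Op Mul (Var vs) (Var vW)) (Var vt)))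
    = Some (n * (W * W) + (s * W + j))%:R.
  apply: eval_addn; first by apply: eval_muln; rewrite /= ?t'n ?t'Z.
  apply: eval_addn; last by rewrite /= t'j.
  by apply: eval_muln; rewrite /= ?t's ?t'W.
have step b : accepted_entry M W r0 r1 q s j = b ->
    vars t' vout + b
    = vars t vout + \sum_(t < j.+1) accepted_entry M W r0 r1 q s t.
  by move=> <-; rewrite It' big_ord_recr /= addrA.
apply: (@runs_weaken _ _ _ (3 + 8) _ (Inv' j.+1)) => //.
apply: (runs_if (v1 := s%:R) (v2 := M%:R * r0 ^+ 2)).
- by rewrite /= t's.
- by rewrite /= t'M t'0 expr2.
rewrite /eval_cmp; case: ifPn => hs; last first.
  apply: (@runs_weaken _ _ _ 0%N _ (Inv' j.+1)) => //; apply: runs_skip.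
  by rewrite /Inv' -(step 0) ?addr0 // /accepted_entry (negbTE hs).
apply: (@runs_weaken _ _ _ (3 + 5) _ (Inv' j.+1)) => //.
apply: (runs_if (v1 := j%:R) (v2 := M%:R * r1 ^+ 2)).
- by rewrite /= t'j.
- by rewrite /= t'M t'1 expr2.
rewrite /eval_cmp; case: ifPn => ht; last first.
  apply: (@runs_weaken _ _ _ 0%N _ (Inv' j.+1)) => //; apply: runs_skip.
  by rewrite /Inv' -(step 0) ?addr0 // /accepted_entry (negbTE ht) andbF.
apply: (runs_assign (v := vars t' vout + q`_(s * W + j))).
  have := eval_get atab evidx; rewrite t'T hq.
  by move: (Get _ _) => g /= ->.
by rewrite /Inv' /= -(step _ erefl) /accepted_entry hs ht.
Qed.

Lemma score_coords (R : realType) (n M : nat) (C : 'rV[R]_n)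
    (m : {ffun 'I_n -> 'I_M}) :
  (\sum_(j < n) score1 M (coords C j) (m j))%N = score C m.
Proof. by apply: eq_bigr => j _; rewrite /coords valK. Qed.

(** The coefficient of gen at s W + t is the proportion of cells with scores
(s, t), because packing is injective on pairs of numbers below W. *)
Lemma sum_accepted_entry (R : realType) (n M W : nat) (C0 C1 : 'rV[R]_n)
    (r0 r1 : R) :
  (forall m : {ffun 'I_n -> 'I_M}, score C0 m < W)%N ->
  (forall m : {ffun 'I_n -> 'I_M}, score C1 m < W)%N ->
  \sum_(s < W) \sum_(t < W)
    accepted_entry M W r0 r1 (gen M W (coords C0) (coords C1) n) s t
  = #|accepted_cells M C0 C1 r0 r1|%:R / M%:R ^+ n.
Proof.
move=> h0 h1.
pose ok s t := (s%:R <= M%:R * r0 ^+ 2) && (t%:R <= M%:R * r1 ^+ 2).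
have entryE (s t : 'I_W) :
    accepted_entry M W r0 r1 (gen M W (coords C0) (coords C1) n) s t
    = \sum_(m : {ffun 'I_n -> 'I_M}) M%:R^-1 ^+ n
        * (ok s t && ((s == score C0 m :> nat) && (t == score C1 m :> nat)))%:R.
  rewrite /accepted_entry -/(ok s t); case: (ok s t); last first.
    by rewrite big1 // => m _; rewrite mulr0.
  rewrite gen_sum coef_sum; apply: eq_bigr => m _.
  rewrite coefZ coefXn sum_weight !score_coords; congr (_ * (nat_of_bool _)%:R).
  rewrite andTb; apply/eqP/andP => [e|[/eqP-> /eqP->] //].
  have W0 : (0 < W)%N by exact: leq_ltn_trans (ltn_ord s).
  have := congr1 (divn^~ W) e; have := congr1 (modn^~ W) e.
  rewrite !modnMDl !divnMDl // !modn_small ?divn_small // ?addn0.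
  by move=> -> ->.
under eq_bigr => s _ do under eq_bigr => t _ do rewrite entryE.
under eq_bigr => s _ do rewrite exchange_big /=.
rewrite exchange_big /= -exprVn mulrC -sum1_card natr_sum mulr_sumr.
rewrite [RHS]big_mkcond /=; apply: eq_bigr => m _.
under eq_bigr => s _ do rewrite -mulr_sumr.
rewrite -mulr_sumr inE -/(ok _ _).
rewrite (bigD1 (Ordinal (h0 m))) //= (bigD1 (Ordinal (h1 m))) //= !eqxx andbT.
rewrite big1 ?addr0 => [|t /eqP ne]; last first.
  by rewrite (_ : _ == _ = false) ?andbF //; apply/eqP => e; apply/ne/val_inj.
rewrite big1 ?addr0 => [|s /eqP ne]; first by case: (ok _ _); rewrite ?mulr0.
rewrite big1 // => t _; rewrite (_ : _ == _ = false) ?andbF //.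
by apply/eqP => e; apply/ne/val_inj.
Qed.

(** * The whole program *)

Fixpoint monomial (K d : nat) : expr :=
  if d is d'.+1 then Op Mul (monomial K d') (Var vn) else nat_cst K.

Lemma eval_monomial (R : realType) (s : state R) (K d n : nat) :
  vars s vn = n%:R -> eval s (monomial K d) = Some (K * n ^ d)%:R.
Proof.
move=> sn; elim: d => [|d IH]; first by rewrite muln1 eval_nat_cst.
by rewrite expnSr mulnA; apply: eval_muln => //=; rewrite sn.
Qed.

Lemma cost_monomial (K d : nat) : cost (monomial K d) = d.
Proof. by elim: d => //= d ->; rewrite addn0. Qed.

(** D = trunc(1/delta) + 1, B = K n^d, M = B D cells per edge and W = M B, a
strict upper bound on all scores. *)
Definition Volume (K d : nat) : prog :=
  Seq (Assign vtmp (Op Div (nat_cst 1) (Var vdelta)))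
 (Seq (Floor vD vtmp)
 (Seq (Assign vD (Op Add (Var vD) (nat_cst 1)))
 (Seq (Assign vB (monomial K d))
 (Seq (Assign vM (Op Mul (Var vB) (Var vD)))
 (Seq (Assign vW (Op Mul (Var vM) (Var vB)))
 (Seq (Assign vZ (Op Mul (Var vW) (Var vW)))
 (Seq (Put atab (nat_cst 0) (nat_cst 1))
 (Seq FillTable
 (Seq Collect
      (Assign vn (Var vout))))))))))).

Lemma volume_cost_le (n T B M W d : nat) :
  (0 < n)%N -> (0 < B)%N -> (n <= B)%N -> M = (B * T.+1)%N -> W = (M * B)%N ->
  (1 + (3 * T + 2 + (1 + (d + (1 + (1 + (1 + (0 +
    (n * (M * (6 * W + 18 * (W * W) + 19) + 3) + 1
     + (W * (W * 13 + 3) + 1 + 0))))))))) <= (d + 100) * W ^ 4)%N.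
Proof.
move=> n0 B0 nB EM EW.
have TM : (T < M)%N by rewrite EM; nia.
have MW : (M <= W)%N by rewrite EW leq_pmulr.
have nW : (n <= W)%N by rewrite EW EM; nia.
have {EM EW} TW : (T <= W)%N by lia.
have W0 : (1 <= W)%N by lia.
have h1 : (M * (6 * W + 18 * (W * W) + 19) + 3 <= 46 * (W * (W * W)))%N by nia.
have h2 : (n * (M * (6 * W + 18 * (W * W) + 19) + 3) <= W * (46 * (W * (W * W))))%N.
  exact: leq_mul.
rewrite (_ : W ^ 4 = W * (W * (W * W)))%N; last by rewrite !expnS expn0 muln1.
have h3 : (W <= W * (W * (W * W)))%N by rewrite leq_pmulr // !muln_gt0 W0.
have h4 : (W * W <= W * (W * (W * W)))%N.
  by rewrite leq_mul // leq_pmulr // muln_gt0 W0.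
nia.
Qed.

Lemma runs_volume (R : realType) (K d n : nat) (C0 C1 : 'rV[R]_n)
    (r0 r1 delta : R) :
  let T := Num.truncn delta^-1 in
  let B := (K * n ^ d)%N in
  let M := (B * T.+1)%N in
  (0 < n)%N -> (n <= B)%N -> 0 < delta ->
  \sum_i (2^-1 + 2 * (C0 0 i - 2^-1) ^+ 2) < B%:R ->
  \sum_i (2^-1 + 2 * (C1 0 i - 2^-1) ^+ 2) < B%:R ->
  runs (Volume K d) (input C0 C1 r0 r1 delta) ((d + 100) * (M * B) ^ 4)
    (fun t => output t = #|accepted_cells M C0 C1 r0 r1|%:R / M%:R ^+ n).
Proof.
move=> T B M n0 nB delta0 sC0 sC1; set W := (M * B)%N.
have B0 : (0 < B)%N by exact: leq_trans nB.
have M0 : (0 < M)%N by rewrite muln_gt0 B0.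
have sum_coords (C : 'rV[R]_n) :
    \sum_(j < n) (2^-1 + 2 * (coords C j - 2^-1) ^+ 2)
    = \sum_i (2^-1 + 2 * (C 0 i - 2^-1) ^+ 2).
  by apply: eq_bigr => i _; rewrite /coords valK.
have lt0 i (a : 'I_i -> nat) : (i <= n)%N -> (forall j, (a j < M)%N) ->
    (\sum_(j < i) score1 M (coords C0 j) (a j) < W)%N.
  by move=> iN aM; apply: (score_sum_lt iN) => //; rewrite sum_coords.
have lt1 i (a : 'I_i -> nat) : (i <= n)%N -> (forall j, (a j < M)%N) ->
    (\sum_(j < i) score1 M (coords C1 j) (a j) < W)%N.
  by move=> iN aM; apply: (score_sum_lt iN) => //; rewrite sum_coords.
apply: runs_weaken; last 1 first.
- by move=> t; exact.
- apply: (runs_assign_seq (v := delta^-1)).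
    by rewrite /= ratr_nat gt_eqF // div1r.
  apply: runs_seq; first exact: runs_frame (@runs_floor _ vD vtmp _ _).
  move=> s1 [s1D s1F]; have {}s1D : vars s1 vD = T%:R by [].
  apply: (runs_assign_seq (v := T.+1%:R)).
    by rewrite -[T.+1]addn1; apply: eval_addn; rewrite ?eval_nat_cst //= s1D.
  apply: (runs_assign_seq (v := B%:R)).
    by apply: eval_monomial; rewrite /= s1F.1.
  apply: (runs_assign_seq (v := M%:R)); first by apply: eval_muln.
  apply: (runs_assign_seq (v := W%:R)); first by apply: eval_muln.
  apply: (runs_assign_seq (v := (W * W)%:R)); first by apply: eval_muln.
  set s2 := set_var _ vZ _.
  apply: (runs_seq (Mid := fun t => t = set_arr s2 atab 0 1%:R)).
    by apply: (runs_put (k := 0%N) (v := 1%:R)) => //; exact: eval_nat_cst.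
  move=> _ ->; set s3 := set_arr _ _ _ _.
  have s3E : env n M W (coords C0) (coords C1) s3.
    by split=> //=; [rewrite s1F.1|split; rewrite s1F.2].
  have s3T : arrs s3 atab = (fun k => (k == 0%N)%:R).
    by apply/funext => k; rewrite /= s1F.2 //=; case: (k == 0%N).
  (* One score is at most the sum of n scores for a constant choice of piece. *)
  have single (C : 'rV[R]_n) : (forall i (a : 'I_i -> nat), (i <= n)%N ->
        (forall j, (a j < M)%N) ->
        \sum_(j < i) score1 M (coords C j) (a j) < W)%N ->
      forall i a, (i < n)%N -> (a < M)%N -> (score1 M (coords C i) a < W)%N.
    move=> ltC i a iN aM.
    apply: leq_ltn_trans (ltC n (fun=> a) (leqnn n) (fun=> aM)).
    by rewrite (bigD1 (Ordinal iN)) //= leq_addr.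
  apply: runs_seq.
    apply: runs_frame; apply: runs_fill_table M0 s3E _ _ _ s3T.
    + move=> i iN; apply: size_gen => m.
        by apply: lt0 => [|j]; [exact: ltnW|exact: ltn_ord].
      by apply: lt1 => [|j]; [exact: ltnW|exact: ltn_ord].
    + exact: single lt0.
    + exact: single lt1.
  move=> s4 [s4T s4F].
  have s4E := env_frame s4F isT isT s3E.
  apply: runs_seq.
    apply: (runs_collect (r0 := r0) (r1 := r1) s4E _ _ _ s4T);
      by rewrite s4F.1 //= s1F.1.
  move=> s5 s5out; apply: runs_assign; first by [].
  rewrite /output /= s5out; apply: sum_accepted_entry => m.
    by rewrite -score_coords; exact: lt0.
  by rewrite -score_coords; exact: lt1.
- rewrite cost_monomial.
  exact: (@volume_cost_le n T B M W d).
Qed.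

(** * Polynomial complexity *)

(** For n >= 1 each term is at most its absolute coefficient times n^(size P). *)
Lemma poly_le_monomial (R : realType) (P : {poly R}) :
  exists K d : nat,
    (0 < K)%N /\ forall n, (0 < n)%N -> P.[n%:R] <= (K * n ^ d)%:R.
Proof.
exists (Num.truncn (\sum_(i < size P) `|P`_i|)).+1, (size P).
split=> // n n0; have n1 : 1 <= n%:R :> R by rewrite ler1n.
rewrite horner_coef natrM natrX.
apply: (@le_trans _ _ ((\sum_(i < size P) `|P`_i|) * n%:R ^+ size P)).
  rewrite mulr_suml ler_sum // => i _.
  apply: le_trans (ler_norm _) _; rewrite normrM normrX normr_nat.
  by rewrite ler_wpM2l // ler_weXn2l // ltnW.
by rewrite ler_wpM2r ?exprn_ge0 // ltW // truncnS_gt.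
Qed.
Unset Implicit Arguments.
Set Strict Implicit.
Set Printing Implicit Defensive.

Theorem mainTheorem1 (R : realType) (P : {poly R}) :
  exists (p : prog) (Q : {poly {poly R}}),
  forall (n : nat) (C0 C1 : 'rV[R]_n) (r0 r1 delta : R),
    (1 <= n)%N -> 0 < r0 -> 0 < r1 -> 0 < delta < 1 ->
    (forall x, unit_cube R n x -> 1 <= enorm (x - C0)) ->
    (forall x, unit_cube R n x -> 1 <= enorm (x - C1)) ->
    (forall x, unit_cube R n x ->
       `|r0 ^+ 2 - enorm (x - C0) ^+ 2| <= P.[n%:R]) ->
    (forall x, unit_cube R n x ->
       `|r1 ^+ 2 - enorm (x - C1) ^+ 2| <= P.[n%:R]) ->
    enorm (C0 - 2^-1 *: const_mx 1) <= P.[n%:R] ->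
    enorm (C1 - 2^-1 *: const_mx 1) <= P.[n%:R] ->
    exists (s : state R) (k : nat),
      [/\ exec p (input C0 C1 r0 r1 delta) s k,
          (`|(output s)%:E
             - vol (unit_cube R n `&` closed_eball C0 r0 `&` closed_eball C1 r1)|
           <= delta%:E)%E &
          k%:R <= Q.[n%:R, delta^-1] `^ (1 + log2 n%:R)].
Proof.
(* The first three terms are required by vol_approx; the last one also makes B
   a bound on the sums of score_sum_lt. *)
have [K [d [K0 leKd]]] := poly_le_monomial
  (4 *: 'X^2 * (P + 1) + 'X + 2%:P + 2 *: P ^+ 2).
(* W = B D B with D <= 2 / delta, and the cost is at most (d + 100) W^4. *)
pose kappa := ((d + 100) * (2 * K ^ 2) ^ 4)%N.
pose Q : {poly {poly R}} := (kappa%:R *: 'X^4)%:P * 'X^(8 * d).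
exists (Volume K d), Q.
move=> n C0 C1 r0 r1 delta n0 r00 r10 /andP[delta0 delta1] far0 far1 _ _ Cp0 Cp1.
set p := P.[n%:R] in Cp0 Cp1; set B := (K * n ^ d)%N.
have leB : 4 * n%:R ^+ 2 * (p + 1) + n%:R + 2 + 2 * p ^+ 2 <= B%:R.
  apply: le_trans (leKd n n0); rewrite le_eqVlt; apply/orP; left; apply/eqP.
  by rewrite !hornerE /= -/p; ring.
have p0 : 0 <= p by apply: le_trans Cp0; exact: sqrtr_ge0.
have n1 : 1 <= n%:R :> R by rewrite ler1n.
have leB1 : 4 * n%:R ^+ 2 * (p + 1) + n%:R + 2 <= B%:R.
  by apply: le_trans leB; rewrite lerDl mulr_ge0 // sqr_ge0.
have sumB (C : 'rV[R]_n) : enorm (C - 2^-1 *: const_mx 1) <= p ->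
    \sum_i (2^-1 + 2 * (C 0 i - 2^-1) ^+ 2) < B%:R.
  move=> Cp; rewrite big_split /= sumr_const card_ord -mulr_sumr -[_ *+ n]mulr_natl.
  have := center_sqdist_le Cp => h; apply: lt_le_trans leB.
  have : 0 <= 4 * n%:R ^+ 2 * (p + 1) :> R.
    by rewrite mulr_ge0 ?mulr_ge0 ?sqr_ge0 // addr_ge0.
  lra.
have nB : (n <= B)%N.
  rewrite -(ler_nat R); apply: le_trans leB1.
  have : 0 <= 4 * n%:R ^+ 2 * (p + 1) :> R.
    by rewrite mulr_ge0 ?mulr_ge0 ?sqr_ge0 // addr_ge0.
  lra.
pose T := Num.truncn delta^-1; pose M := (B * T.+1)%N.
have y1 : 1 <= delta^-1 by rewrite invf_ge1 // ltW.
have [s [k [ex kc out]]] :=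
  @runs_volume R K d n C0 C1 r0 r1 delta n0 nB delta0 (sumB _ Cp0) (sumB _ Cp1).
exists s, k; split=> //.
  rewrite out; apply: (vol_approx n0 r00 r10 _ _ far0 far1 Cp0 Cp1 leB1) => //.
  by rewrite -ler_pdivrMr // div1r ltW // truncnS_gt.
have QE : Q.[n%:R, delta^-1] = kappa%:R * delta^-1 ^+ 4 * n%:R ^+ (8 * d).
  by rewrite /Q !hornerE /=; ring.
have Ty : T.+1%:R <= 2 * delta^-1.
  have y0 : 0 <= delta^-1 by rewrite invr_ge0 ltW.
  have /andP[h _] := truncn_itv y0.
  by rewrite -natr1; rewrite -/T in h; lra.
have kQ : k%:R <= Q.[n%:R, delta^-1].
  have -> : Q.[n%:R, delta^-1]
      = (d + 100)%:R * (B%:R * (2 * delta^-1) * B%:R) ^+ 4.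
    rewrite QE /kappa /B !(natrM, natrX).
    rewrite (_ : 8 * d = d * 2 * 4)%N; last by lia.
    by rewrite !exprM; ring.
  apply: (@le_trans _ _ ((d + 100) * (M * B) ^ 4)%:R); first by rewrite ler_nat.
  rewrite natrM natrX ler_wpM2l // ler_pXn2r ?nnegrE //; last first.
    by rewrite !mulr_ge0 // invr_ge0 ltW.
  by rewrite /M !natrM ler_wpM2r // ler_wpM2l.
apply: le_trans kQ _.
have Q1 : 1 <= Q.[n%:R, delta^-1].
  rewrite QE -[X in X <= _]mulr1 -[X in X * _ <= _]mulr1.
  rewrite ler_pM ?mulr_ge0 ?ler_pM ?exprn_ege1 //.
  by rewrite ler1n /kappa muln_gt0 addn_gt0 orbT /= !expn_gt0 muln_gt0 expn_gt0 K0.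
rewrite -[leLHS]powRr1 ?(le_trans _ Q1) //; apply: ler_powR => //.
by rewrite lerDl /log2 divr_ge0 // ln_ge0 // ler1n.
Qed.
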